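(* Let $n\ge 3$ and let $s\in\mathbb{R}$. Suppose that there is a constant $C_s<\infty$ such that $$\Big\|\sup_{0<t<1}\big|e^{it\Delta}f\big|\Big\|_{L^2(\mathbb{R}^n)}\le C_s\|f\|_{H^s(\mathbb{R}^n)}$$ for every Schwartz function $f$ on $\mathbb{R}^n$. Then $s\ge\frac{n}{n+2}$.
   Context: For a Schwartz function $f$ on $\mathbb{R}^n$, with Fourier transform $\widehat f(\xi)=\int_{\mathbb{R}^n} f(x)e^{-2\pi i x\cdot\xi}\,dx$, $$e^{it\Delta}f(x)=\int_{\mathbb{R}^n}\widehat{f}(\xi)\,e^{2\pi i x\cdot\xi-4\pi^2 i t|\xi|^2}\,d\xi .$$ $H^s(\mathbb{R}^n)$ is the inhomogeneous $L^2$-Sobolev space, with norm $\|f\|_{H^s}=\|(1+|\xi|^2)^{s/2}\widehat f(\xi)\|_{L^2(\mathbb{R}^n)}$. *)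

(* Defs.v *)
From HB Require Import structures.
From mathcomp Require Import all_boot all_order all_algebra.
From mathcomp Require Import complex.
From mathcomp Require Import all_classical all_reals all_analysis.

Set Implicit Arguments.
Unset Strict Implicit.
Unset Printing Implicit Defensive.

Import Order.TTheory GRing.Theory Num.Theory.
Import numFieldNormedType.Exports.

Local Open Scope classical_set_scope.
Local Open Scope ring_scope.

(* [R^n] is ['rV[R]_n].  Pitfall: its library norm [`|x|] is the sup norm, so
   Euclidean quantities are written with [dot]. *)

(* The Borel sigma-algebra of [R^n], generated by the coordinates as the library
   does for [n.-tuple]. *)
Section measurable_rV.
Context (R : realType) (n : nat).

Let coord (i : 'I_n) (x : 'rV[R]_n) : measurableTypeR R := x ord0 i.

Let rV_set0 : g_sigma_preimage coord set0.
Proof. exact: sigma_algebra0. Qed.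

Let rV_setC A : g_sigma_preimage coord A -> g_sigma_preimage coord (~` A).
Proof. exact: sigma_algebraC. Qed.

Let rV_bigcup (F : (set 'rV[R]_n)^nat) : (forall i, g_sigma_preimage coord (F i)) ->
  g_sigma_preimage coord (\bigcup_i (F i)).
Proof. exact: sigma_algebra_bigcup. Qed.

HB.instance Definition _ :=
  @isMeasurable.Build (measure_tuple_display default_measure_display)
    'rV[R]_n (g_sigma_preimage coord) rV_set0 rV_setC rV_bigcup.

Lemma measurable_rV_coord (i : 'I_n) :
  measurable_fun [set: 'rV[R]_n] (fun x : 'rV[R]_n => x ord0 i : measurableTypeR R).
Proof.
move=> _ Y mY; rewrite setTI; apply: sub_sigma_algebra => /=.
rewrite -bigcup_seq/=; exists i => /=; first by rewrite mem_index_enum.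
by exists Y => //; rewrite setTI.
Qed.

Lemma measurable_fun_rVP d (T : measurableType d) (f : T -> 'rV[R]_n) :
  (forall i, measurable_fun setT (fun x => f x ord0 i : measurableTypeR R)) ->
  measurable_fun setT f.
Proof.
move=> mf _ A mA; rewrite setTI.
suff : g_sigma_preimage coord `<=` [set B | measurable (f @^-1` B)] by apply.
apply: smallest_sub.
  split=> /= [|B mB|F mF].
  - by rewrite preimage_set0.
  - by rewrite setTD preimage_setC; exact: measurableC.
  - by rewrite preimage_bigcup; exact: bigcup_measurable.
rewrite -bigcup_seq => B [i _ [Y mY <-]] /=.
by rewrite setTI -[X in measurable X]setTI; exact: mf.
Qed.

End measurable_rV.

Definition cons_rV (R : realType) (n : nat) (p : measurableTypeR R * 'rV[R]_n) :
  'rV[R]_n.+1 := \row_(i < n.+1) oapp (p.2 ord0) p.1 (unlift ord0 i).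

Lemma measurable_cons_rV (R : realType) (n : nat) :
  measurable_fun setT (@cons_rV R n).
Proof.
apply: measurable_fun_rVP => i; rewrite /cons_rV.
under eq_fun do rewrite mxE.
case: unliftP => [j _|_] /=; last exact: measurable_fst.
by apply: (measurableT_comp (measurable_rV_coord j)); exact: measurable_snd.
Qed.

Definition uncons_rV (R : realType) (n : nat) (x : 'rV[R]_n.+1) :
  measurableTypeR R * 'rV[R]_n :=
  (x ord0 ord0, \row_(i < n) x ord0 (lift ord0 i)).

Lemma cons_rVK (R : realType) (n : nat) : cancel (@cons_rV R n) (@uncons_rV R n).
Proof.
move=> [r x]; rewrite /uncons_rV /cons_rV mxE unlift_none; congr pair.
by apply/rowP => i; rewrite !mxE liftK.
Qed.

Lemma measurable_uncons_rV (R : realType) (n : nat) :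
  measurable_fun setT (@uncons_rV R n).
Proof.
apply/measurable_fun_pairP; split; first exact: measurable_rV_coord.
apply: measurable_fun_rVP => i /=.
by under eq_fun do rewrite mxE; exact: measurable_rV_coord.
Qed.

Section lebesgue_cons.
Local Open Scope ereal_scope.
Context (R : realType) (n : nat).
Variable m : {sigma_finite_measure set 'rV[R]_n -> \bar R}.

Definition lebesgue_cons : set 'rV[R]_n.+1 -> \bar R :=
  pushforward (lebesgue_measure \x m) (@cons_rV R n).

Let lebesgue_cons0 : lebesgue_cons set0 = 0.
Proof. by rewrite /lebesgue_cons /pushforward preimage_set0 measure0. Qed.

Let lebesgue_cons_ge0 A : 0 <= lebesgue_cons A.
Proof. by rewrite /lebesgue_cons /pushforward; exact: measure_ge0. Qed.

Let lebesgue_cons_sigma_additive : semi_sigma_additive lebesgue_cons.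
Proof.
move=> F mF tF mUF; rewrite /lebesgue_cons /pushforward preimage_bigcup.
have mp A : measurable A -> measurable (@cons_rV R n @^-1` A).
  by move=> mA; rewrite -[X in measurable X]setTI; exact: measurable_cons_rV.
apply: measure_semi_sigma_additive.
- by move=> k; exact: mp.
- apply/trivIsetP => /= i j _ _ ij; rewrite -preimage_setI.
  by move/trivIsetP : tF => /(_ _ _ _ _ ij) ->//; rewrite preimage_set0.
- by rewrite -preimage_bigcup; exact: mp.
Qed.

HB.instance Definition _ := isMeasure.Build _ _ _ lebesgue_cons
  lebesgue_cons0 lebesgue_cons_ge0 lebesgue_cons_sigma_additive.

Let lebesgue_cons_sigma_finite : sigma_finite setT lebesgue_cons.
Proof.
have /sigma_finiteP[F [TF ndF Foo]] := sigma_finiteT (@lebesgue_measure R).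
have /sigma_finiteP[G [TG ndG Goo]] := sigma_finiteT m.
exists (fun k => @uncons_rV R n @^-1` (F k `*` G k)).
  rewrite -preimage_bigcup -[LHS](preimage_setT (@uncons_rV R n)); congr preimage.
  rewrite -setXTT TF TG predeqE => -[x y]; split.
    move=> [/= [k _ Fkx] [l _ Gly]]; exists (maxn k l) => //; split.
    - by move: x Fkx; exact/subsetPset/ndF/leq_maxl.
    - by move: y Gly; exact/subsetPset/ndG/leq_maxr.
  by move=> [k _ []/= ? ?]; split; exists k.
move=> k; have [mF Fk] := Foo k; have [mG Gk] := Goo k; split.
  rewrite -[X in measurable X]setTI; apply: measurable_uncons_rV => //.
  exact: measurableX.
rewrite /lebesgue_cons /pushforward -comp_preimage.
rewrite (_ : _ \o _ = idfun) ?preimage_id; last first.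
  by apply/funext => p /=; rewrite cons_rVK.
by rewrite product_measure1E// lte_mul_pinfty// ge0_fin_numE.
Qed.

HB.instance Definition _ := Measure_isSigmaFinite.Build _ _ _ lebesgue_cons
  lebesgue_cons_sigma_finite.

End lebesgue_cons.

Fixpoint lebesgue_rV (R : realType) (n : nat) :
    {sigma_finite_measure set 'rV[R]_n -> \bar R} :=
  if n is k.+1 then lebesgue_cons (lebesgue_rV R k) else dirac (0 : 'rV[R]_0).

(* The characteristic property of n-dimensional Lebesgue measure. *)
Lemma lebesgue_rV_box (R : realType) (n : nat) (A : 'I_n -> set (measurableTypeR R)) :
  (forall i, measurable (A i)) ->
  (lebesgue_rV R n [set x : 'rV[R]_n | forall i, A i (x ord0 i)] =
   \prod_(i < n) lebesgue_measure (A i))%E.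
Proof.
elim: n A => [|n IHn] A mA /=.
  by rewrite big_ord0 /dirac indicE mem_set//= => -[].
rewrite big_ord_recl -IHn// /lebesgue_cons /pushforward -product_measure1E//.
  congr (_ _); apply/seteqP; split=> -[r x] /=.
    move=> Ax; split; first by have := Ax ord0; rewrite mxE unlift_none.
    by move=> i; have := Ax (lift ord0 i); rewrite mxE liftK.
  by move=> [Ar Ax] i; rewrite mxE; case: unliftP => [j|] ->.
rewrite (_ : mkset _ = \big[setI/setT]_(i < n)
    ((fun x : 'rV[R]_n => x ord0 i) @^-1` A (lift ord0 i))).
  apply: big_rec => // i B _ mB; apply: measurableI => //.
  by rewrite -[X in measurable X]setTI; exact: measurable_rV_coord.
rewrite -bigcap_seq; apply/seteqP; split=> x /= Ax i; first by move=> _; exact: Ax.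
by apply: Ax => /=; rewrite mem_index_enum.
Qed.

Section schroedinger.
Context (R : realType) (n : nat).
Implicit Types (f : 'rV[R]_n -> R[i]) (x xi : 'rV[R]_n) (t s : R).

Definition dot x xi : R := \sum_(i < n) x ord0 i * xi ord0 i.

(* exp (i theta) *)
Definition cis (theta : R) : R[i] := Complex (cos theta) (sin theta).

(* [R[i]] is not a normed module over [R] in the library: its functions are
   integrated and differentiated through their real and imaginary parts. *)
Definition cintegral f : R[i] :=
  Complex (\int[lebesgue_rV R n]_x complex.Re (f x))
          (\int[lebesgue_rV R n]_x complex.Im (f x)).

Definition re_part f (x : 'rV[R]_n) : R := complex.Re (f x).
Definition im_part f (x : 'rV[R]_n) : R := complex.Im (f x).

Definition partial (i : 'I_n) f (x : 'rV[R]_n) : R[i] :=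
  Complex ('D_(delta_mx ord0 i) (re_part f) x) ('D_(delta_mx ord0 i) (im_part f) x).

Definition partials (b : seq 'I_n) f : 'rV[R]_n -> R[i] := foldr partial f b.

Definition smooth f : Prop := forall b : seq 'I_n,
  [/\ continuous (re_part (partials b f)), continuous (im_part (partials b f)) &
    forall (i : 'I_n) x, derivable (re_part (partials b f)) x (delta_mx ord0 i) /\
      derivable (im_part (partials b f)) x (delta_mx ord0 i)].

(* [a] is the multi-index of the monomial; the list [b] names the variables of
   the successive partial derivatives. *)
Definition schwartz f : Prop := smooth f /\
  forall (a : 'I_n -> nat) (b : seq 'I_n), exists M : R, forall x,
    `|\prod_(i < n) x ord0 i ^+ a i| * Normc.normc (partials b f x) <= M.

Definition fourier f xi : R[i] :=
  cintegral (fun x => f x * cis (- (2 * pi * dot x xi))).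

Definition schroedinger t f x : R[i] :=
  cintegral (fun xi =>
    fourier f xi * cis (2 * pi * dot x xi - 4 * pi ^+ 2 * t * dot xi xi)).

Definition schroedinger_max f x : \bar R :=
  ereal_sup [set (Normc.normc (schroedinger t f x))%:E | t in `]0, 1[ ].

Definition sobolev_norm s f : \bar R :=
  let g xi := (1 + dot xi xi) `^ (s / 2) * Normc.normc (fourier f xi) in
  ('N[lebesgue_rV R n]_2%:E[EFin \o g])%E.

End schroedinger.

(* Main.v *)
Require Import Defs.
From mathcomp Require Import all_boot all_order all_algebra.
From mathcomp Require Import complex ring lra.
From mathcomp Require Import all_classical all_reals all_analysis.
From mathcomp Require Import measurable_realfun lebesgue_integral_under.

(* Idea: test the estimate on a superposition f of 1-d wave packets, tensorized.
   Let N be large, Q = 64 N, L = Q^(n/2), r = L N and W = 1000 r.  The j-th factor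
   of f is exp (- pi y^2 / W^2) times the sum over k < N of e(xi_{j,k} y), where
   e(x) = exp (2 pi i x) and xi_{j,k} = L (k + Q^-(j+1) / 2): frequencies on an
   L-spaced lattice up to r, shifted by a Galilean boost that depends on j.
   At time t = m / (2 pi L^2) the N packets of the j-th factor are in phase at x_j
   as soon as L x_j - m Q^-(j+1) is within 1 / Q of an integer.  Choosing the
   base-Q digits of m, this can be achieved for all j simultaneously with
   1 <= m <= Q^n = L^2, so that 0 < t < 1.  Hence the maximal function is at least
   (N / 2)^n on the cube [0, r]^n, while ||f||_{H^s}^2 is at most a constant times
   r^(2 s) (N r)^n.  The estimate thus gives N^n <~ r^(2 s) ~ N^((n + 2) s). *)

Set Implicit Arguments.
Unset Strict Implicit.
Unset Printing Implicit Defensive.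

Import Order.TTheory GRing.Theory Num.Theory.
Import numFieldNormedType.Exports.

Local Open Scope classical_set_scope.
Local Open Scope ring_scope.

(** * Complex numbers and real integrals *)

Section complex_numbers.
Context {R : realType}.
Local Notation "x %:C" := (Complex x 0).

(** The obstacle is that one time must focus all [n] coordinates at once. With [xi = L (k + Th / 2)]
    and [t = m / (2 pi L^2)], the phase [y xi - 2 pi t xi^2], counted in turns, equals
    [k (L y - m Th) - m k^2] plus terms free of [k]. The quadratic term is an integer, so only
    [L y - m Th] modulo 1 matters. Without the boost [Th] the integer [m] would drop out, and at
    these times focusing would be confined to [y] near the lattice of spacing [1 / L]. With
    [Th = Q^-(j+1)], each coordinate brings one fresh base-[Q] digit of [m] into play. Taking
    [Q = 64 N] keeps the accumulated error [k / Q] below [1 / 64] of a turn, and [L^2 = Q^n] leaves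
    room for [n] digits before time 1. A Gaussian envelope has an explicit, nonnegative transform of
    width [1 / W]; as [W] is a large multiple of [r], this spread of frequencies perturbs the phase
    only slightly on the cube. *)

Lemma ReD (x y : R[i]) : complex.Re (x + y) = complex.Re x + complex.Re y.
Proof. by case: x y => a b []. Qed.

Lemma ImD (x y : R[i]) : complex.Im (x + y) = complex.Im x + complex.Im y.
Proof. by case: x y => a b []. Qed.

Lemma Re_mul (x y : R[i]) :
  complex.Re (x * y) = complex.Re x * complex.Re y - complex.Im x * complex.Im y.
Proof. by case: x y => a b [c d]. Qed.

Lemma Im_mul (x y : R[i]) :
  complex.Im (x * y) = complex.Re x * complex.Im y + complex.Im x * complex.Re y.
Proof. by case: x y => a b [c d]. Qed.

Lemma Re_sum n (F : 'I_n -> R[i]) :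
  complex.Re (\sum_(k < n) F k) = \sum_(k < n) complex.Re (F k).
Proof. by elim/big_ind2 : _ => // x x' y1 y2 <- <-; rewrite ReD. Qed.

Lemma sum_real_complex n (F : 'I_n -> R) :
  \sum_(k < n) (F k)%:C = (\sum_(k < n) F k)%:C.
Proof.
apply: esym; elim/big_ind2 : _ => // x x' y y' <- <-.
by rewrite [RHS]/GRing.add/= addr0.
Qed.

Lemma prod_real_complex n (F : 'I_n -> R) :
  \prod_(j < n) (F j)%:C = (\prod_(j < n) F j)%:C.
Proof.
apply: esym; elim/big_ind2 : _ => // x x' y y' <- <-.
by rewrite [RHS]/GRing.mul/= !mulr0 !mul0r subr0 addr0.
Qed.

Lemma normc_prod n (F : 'I_n -> R[i]) :
  Normc.normc (\prod_(j < n) F j) = \prod_(j < n) Normc.normc (F j).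
Proof.
by elim/big_ind2 : _ => // [|x1 x2 y1 y2 <- <-]; [exact: Normc.normc1|exact: Normc.normcM].
Qed.

Lemma normc_ge0 (x : R[i]) : 0 <= Normc.normc x.
Proof. by case: x => a b; exact: sqrtr_ge0. Qed.

Lemma normc_real (x : R) : Normc.normc x%:C = `|x|.
Proof. by rewrite /= expr0n/= addr0 sqrtr_sqr. Qed.

Lemma normc_le (x y : R) : Normc.normc (Complex x y) <= `|x| + `|y|.
Proof.
rewrite /= -(ger0_norm (addr_ge0 (normr_ge0 x) (normr_ge0 y))) -sqrtr_sqr ler_sqrt ?sqr_ge0//.
rewrite sqrrD !real_normK ?num_real// -addrA lerD2l lerDr.
by rewrite mulrn_wge0 ?mulr_ge0.
Qed.

Lemma normc_ge_Re (x : R[i]) : complex.Re x <= Normc.normc x.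
Proof.
case: x => a b /=; rewrite (le_trans (ler_norm a))// -sqrtr_sqr ler_sqrt ?addr_ge0 ?sqr_ge0//.
by rewrite lerDl sqr_ge0.
Qed.

Lemma cisD (x y : R) : cis (x + y) = cis x * cis y.
Proof. by rewrite /cis cosD sinD [RHS]/GRing.mul/= [X in Complex _ X]addrC. Qed.

Lemma cis_sum n (F : 'I_n -> R) : cis (\sum_(i < n) F i) = \prod_(i < n) cis (F i).
Proof.
elim/big_ind2 : _ => [|x x' y y' <- <-|//]; last by rewrite cisD.
by rewrite /cis cos0 sin0.
Qed.

Lemma normc_cis (x : R) : Normc.normc (cis x) = 1.
Proof. by rewrite /cis /= cos2Dsin2 sqrtr1. Qed.

Lemma mulr_cis (r x : R) : r%:C * cis x = Complex (r * cos x) (r * sin x).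
Proof. by rewrite [LHS]/GRing.mul/= !mul0r subr0 addr0. Qed.

End complex_numbers.

Section integrals.
Context {R : realType}.

Lemma Rintegral_sum d (T : measurableType d) (m : {measure set T -> \bar R})
    n (F : 'I_n -> T -> R) :
  (forall i, m.-integrable setT (EFin \o F i)) ->
  m.-integrable setT (EFin \o (fun x => \sum_(i < n) F i x)) /\
  \int[m]_x (\sum_(i < n) F i x) = \sum_(i < n) \int[m]_x F i x.
Proof.
move=> intF; elim: (index_enum _) => [|i s [IH1 IH2]].
  split; first by under eq_fun do rewrite /= big_nil; exact: integrable0.
  by under eq_Rintegral do rewrite big_nil; rewrite big_nil /Rintegral integral0.
split.
  have := integrableD measurableT (intF i) IH1; apply: eq_integrable => // x _ /=.
  by rewrite big_cons.
under eq_Rintegral do rewrite big_cons.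
by rewrite big_cons -IH2 (RintegralD measurableT (intF i) IH1).
Qed.

(** The maximal function is a supremum over uncountably many times, and its measurability is not
    established here. The integral of a nonnegative function, being a supremum over the simple
    functions below it, is monotone all the same. *)
Lemma le_integral_nonmeasurable d (T : measurableType d)
    (m : {measure set T -> \bar R}) (D : set T) (f g : T -> \bar R) :
  (forall x, D x -> 0 <= f x)%E -> (forall x, 0 <= g x)%E ->
  (forall x, D x -> f x <= g x)%E -> (\int[m]_(x in D) f x <= \int[m]_x g x)%E.
Proof.
move=> f0 g0 fg; rewrite ge0_integralE// ge0_integralTE//.
apply: le_ereal_sup => _ [h hf <-]; exists h => // x; apply: le_trans (hf x) _.
by rewrite patchE; case: ifPn => // /set_mem /fg.
Qed.

End integrals.

(** * The Fourier transform of a Gaussian *)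

Section gaussian.
Context {R : realType}.
Notation mu := (@lebesgue_measure R).
Implicit Types (a b c m x y : R).

(** Rescaling to the normal density of variance [1 / (2 a)] gives access to the integrability and
    total mass of every Gaussian. *)
Lemma gaussian_normal_pdf a m x : 0 < a ->
  expR (- (a * (x - m) ^+ 2)) =
  Num.sqrt (pi / a) * normal_pdf m (Num.sqrt (2 * a))^-1 x.
Proof.
move=> a0; have a20 : 0 < 2 * a by rewrite mulr_gt0.
have s0 : (Num.sqrt (2 * a))^-1 != 0 by rewrite invr_eq0 sqrtr_eq0 -ltNge.
rewrite normal_pdfE// /normal_peak /normal_fun exprVn sqr_sqrtr ?ltW//.
rewrite (_ : (2 * a)^-1 * pi *+ 2 = pi / a); last by field; rewrite gt_eqF.
rewrite [RHS]mulrA mulfV ?mul1r; last first.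
  by rewrite sqrtr_eq0 -ltNge divr_gt0// pi_gt0.
by congr expR; field; rewrite gt_eqF.
Qed.

Lemma integrable_gaussian a m : 0 < a ->
  mu.-integrable setT (fun x => (expR (- (a * (x - m) ^+ 2)))%:E).
Proof.
move=> a0; under eq_fun do rewrite gaussian_normal_pdf// EFinM.
by apply: integrableZl => //; exact: integrable_normal_pdf.
Qed.

Lemma integral_gaussian a m : 0 < a ->
  \int[mu]_x expR (- (a * (x - m) ^+ 2)) = Num.sqrt (pi / a).
Proof.
move=> a0; under eq_Rintegral do rewrite gaussian_normal_pdf//.
rewrite RintegralZl//; last exact: integrable_normal_pdf.
by rewrite /Rintegral integral_normal_pdf mulr1.
Qed.

Lemma integrable_bounded_mulr (f g : R -> R) (M : R) :
  mu.-integrable setT (EFin \o f) -> measurable_fun setT g ->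
  (forall x, `|g x| <= M) ->
  mu.-integrable setT (fun x => (f x * g x)%:E).
Proof.
move=> intf mg gM.
have mf : measurable_fun setT f by apply/measurable_EFinP; exact: measurable_int intf.
apply: (le_integrable measurableT _ _ (integrableZl measurableT M intf)) => //=.
  by apply/measurable_EFinP; exact: measurable_funM.
move=> x _; rewrite lee_fin normrM mulrC normrM ler_wpM2r//.
by rewrite (le_trans (gM x))// ler_norm.
Qed.

End gaussian.

Section fourier_gaussian.
Context {R : realType}.
Notation mu := (@lebesgue_measure R).
Implicit Types (a b c m x y : R).

(** This serves as integration by parts on the whole line: the fundamental theorem on
    [[-(n+1), n+1]] leaves boundary terms of size at most [2 e n], and dominated convergence with
    majorant [|f|] passes to the limit. *)
Lemma integral_derive_eq0 (F f : R -> R) (e : R^nat) :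
  (forall x, is_derive x 1 F (f x)) -> continuous f ->
  mu.-integrable setT (EFin \o f) ->
  (forall n, `|F n.+1%:R| <= e n) -> (forall n, `|F (- n.+1%:R)| <= e n) ->
  e @ \oo --> 0 ->
  \int[mu]_x f x = 0.
Proof.
move=> dF cf intf Fp Fn e0.
have mf : measurable_fun setT f by apply/measurable_EFinP; exact: measurable_int intf.
have Fc : continuous F.
  by move=> x; apply: differentiable_continuous; apply/derivable1_diffP; exact: ex_derive.
pose I n : set R := [set` `[(- n.+1%:R : R), n.+1%:R]].
have FTC n : (\int[mu]_(x in I n) (f x)%:E = (F n.+1%:R - F (- n.+1%:R))%:E)%E.
  rewrite EFinB; apply: continuous_FTC2.
  - by rewrite gtrN.
  - exact: continuous_subspaceT.
  - split => [x _||]; first exact: ex_derive.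
    + by apply: cvg_at_right_filter; exact: Fc.
    + by apply: cvg_at_left_filter; exact: Fc.
  - by move=> x _; rewrite derive1E; apply: derive_val.
have cv1 : (\int[mu]_(x in I n) (f x)%:E @[n --> \oo] --> \int[mu]_x (f x)%:E)%E.
  under eq_fun do rewrite integral_mkcond.
  apply: (@dominated_cvg _ _ _ mu _ measurableT _ _ (fun x => `|f x|%:E)) => //=.
  - move=> n; have mI : measurable (I n) by exact: measurable_itv.
    apply: (measurable_restrictT _ mI).1.
    by apply: measurable_funTS; exact/measurable_EFinP.
  - move=> x _; apply: (@cvg_near_cst _ _ _ _ _ _); near=> n.
    rewrite patchE mem_set// /I/= in_itv/= -ler_norml.
    near: n; exists (Num.truncn `|x|) => // n /= xn.
    rewrite (le_trans (ltW (truncnS_gt _)))// ler_nat ltnS//.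
  - have := integrable_abse intf; by apply: eq_integrable.
  - move=> n x _; rewrite patchE; case: ifPn => _ //=.
    by rewrite normr0 lee_fin.
have cv2 : (\int[mu]_(x in I n) (f x)%:E @[n --> \oo] --> 0%:E)%E.
  under eq_fun do rewrite FTC.
  apply: cvg_EFin; first exact: nearW.
  apply: (@squeeze_cvgr _ _ _ _ (fun n => - (e n + e n)) (fun n => e n + e n)).
  - near=> n; rewrite /= -ler_norml (le_trans (ler_normB _ _))//.
    exact: lerD.
  - by rewrite -oppr0 -[X in - X]addr0; apply: cvgN; apply: cvgD.
  - by rewrite -[X in _ --> X]addr0; apply: cvgD.
by rewrite /Rintegral (cvg_unique _ cv1 cv2).
Unshelve. all: by end_near. Qed.

(** Half of the exponent absorbs the factor: with [u = a x^2 / 2], one has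
    [|x| <= 1 + x^2 <= (1 + 2 / a) (1 + u)] and [1 + u <= expR u]. *)
Lemma normr_gaussian_le a x : 0 < a ->
  `|x| * expR (- (a * x ^+ 2)) <= (1 + 2 / a) * expR (- (a / 2 * x ^+ 2)).
Proof.
move=> a0; set u := a / 2 * x ^+ 2.
have u0 : 0 <= u by rewrite mulr_ge0 ?sqr_ge0// divr_ge0// ltW.
rewrite (_ : a * x ^+ 2 = u + u); last by rewrite /u; field.
rewrite opprD expRD mulrA ler_wpM2r ?expR_ge0//.
rewrite expRN ler_pdivrMr ?expR_gt0//.
have x1 : `|x| <= 1 + x ^+ 2.
  by rewrite -(real_normK (num_real x)); nra.
have eu : 1 + u <= expR u by exact: expR_ge1Dx.
have xE : x ^+ 2 = 2 / a * u by rewrite /u; field; rewrite gt_eqF.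
rewrite xE in x1; have k0 : 0 < 2 / a by rewrite divr_gt0.
rewrite (le_trans x1)//; move: (2 / a) (expR u) k0 eu => k E k0 eu.
by apply: (@le_trans _ _ ((1 + k) * (1 + u))); [nra|rewrite ler_wpM2l//; lra].
Qed.

Lemma measurable_gaussian a : measurable_fun setT (fun x => expR (- (a * x ^+ 2))).
Proof.
apply: continuous_measurable_fun => x.
by apply: continuous_comp; [apply: cvgN; apply: cvgM;
  [exact: cvg_cst|exact: exprn_continuous]|exact: continuous_expR].
Qed.

Lemma integrable_gaussian0 a : 0 < a ->
  mu.-integrable setT (fun x => (expR (- (a * x ^+ 2)))%:E).
Proof.
move=> a0; have := @integrable_gaussian R a 0 a0.
by apply: eq_integrable => // x _; rewrite subr0.
Qed.

Lemma integrable_normr_gaussian a : 0 < a ->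
  mu.-integrable setT (fun x => (`|x| * expR (- (a * x ^+ 2)))%:E).
Proof.
move=> a0; have a20 : 0 < a / 2 by rewrite divr_gt0.
apply: (le_integrable measurableT _ _
  (integrableZl measurableT (1 + 2 / a) (integrable_gaussian0 a20))) => //=.
  apply/measurable_EFinP; apply: measurable_funM; last exact: measurable_gaussian.
  exact: normr_measurable.
have k0 : 0 <= 1 + 2 / a by rewrite addr_ge0// divr_ge0// ltW.
move=> x _; rewrite lee_fin !normrM normr_id !(ger0_norm (expR_ge0 _)).
by rewrite (ger0_norm k0) normr_gaussian_le.
Qed.

(** The integral is studied as a function of [b]: differentiation under the integral sign followed
    by integration by parts yields a linear differential equation in [b], whose initial value is the
    Gaussian integral. The phase [c] covers the cosine and sine transforms at once, the latter being
    [c = - pi / 2]. *)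
Lemma fourier_gaussian_cos a b c : 0 < a ->
  \int[mu]_x (expR (- (a * x ^+ 2)) * cos (b * x + c)) =
  Num.sqrt (pi / a) * expR (- (b ^+ 2 / (4 * a))) * cos c.
Proof.
move=> a0; pose G x := expR (- (a * x ^+ 2)).
have dG x : is_derive x 1 G (- (2 * a * x * G x)).
  by rewrite /G; apply: is_derive_eq; rewrite !scaler1 /GRing.scale/=; ring.
have cG : continuous G.
  by move=> x; apply: differentiable_continuous; apply/derivable1_diffP; exact: ex_derive.
have mlin b' : continuous (fun x => b' * x + c).
  by move=> x; apply: cvgD; [apply: cvgM; [exact: cvg_cst|exact: cvg_id]|exact: cvg_cst].
have ccos b' : continuous (fun x => cos (b' * x + c)).
  by move=> x; apply: continuous_comp; [exact: mlin|exact: continuous_cos].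
have csin b' : continuous (fun x => sin (b' * x + c)).
  by move=> x; apply: continuous_comp; [exact: mlin|exact: continuous_sin].
have iGcos b' : mu.-integrable setT (fun x => (G x * cos (b' * x + c))%:E).
  apply: (@integrable_bounded_mulr _ _ _ 1); first exact: integrable_gaussian0.
  - exact: continuous_measurable_fun.
  - by move=> x; exact: cos_max.
have ixG : mu.-integrable setT (fun x => (x * G x)%:E).
  apply: (le_integrable measurableT _ _ (integrable_normr_gaussian a0)) => //=.
    apply/measurable_EFinP; apply: measurable_funM => //; exact: measurable_gaussian.
  by move=> x _; rewrite lee_fin !normrM normr_id.
have ixGsin b' : mu.-integrable setT (fun x => (x * G x * sin (b' * x + c))%:E).
  apply: (@integrable_bounded_mulr _ _ _ 1); first exact: ixG.
  - exact: continuous_measurable_fun.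
  - by move=> x; exact: sin_max.
(* Decay of the boundary terms: [exp (a x^2) >= 1 + a x^2 >= a x] for [x >= 1]. *)
have Gn n y : G n.+1%:R * `|sin y| <= a^-1 * harmonic n.
  rewrite (@le_trans _ _ (G n.+1%:R))//; first by rewrite ler_piMr ?expR_ge0// sin_max.
  rewrite /G expRN /harmonic/= -invfM lef_pV2 ?posrE ?expR_gt0 ?mulr_gt0//.
  rewrite (le_trans _ (expR_ge1Dx _))//.
  have n1 : 1 <= n.+1%:R :> R by rewrite ler1n.
  by have := mulr_gt0 a0 (lt_le_trans ltr01 n1); nra.
have by_parts b' : \int[mu]_x (x * G x * sin (b' * x + c)) =
    b' / (2 * a) * \int[mu]_x (G x * cos (b' * x + c)).
  have : \int[mu]_x (b' * (G x * cos (b' * x + c)) -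
                     2 * a * (x * G x * sin (b' * x + c))) = 0.
    apply: (@integral_derive_eq0 (fun x => G x * sin (b' * x + c)) _
              (fun n => a^-1 * harmonic n)).
    - move=> x; apply: is_derive_eq.
      by rewrite /GRing.scale/= !mulr1 ?addr0; ring.
    - move=> x; apply: cvgB; (apply: cvgM; first exact: cvg_cst).
      + by apply: cvgM; [exact: cG|exact: ccos].
      + by apply: cvgM; [apply: cvgM; [exact: cvg_id|exact: cG]|exact: csin].
    - have := integrableB measurableT (integrableZl measurableT b' (iGcos b'))
        (integrableZl measurableT (2 * a) (ixGsin b')).
      exact: eq_integrable.
    - by move=> n; rewrite normrM ger0_norm ?expR_ge0// Gn.
    - by move=> n; rewrite normrM ger0_norm ?expR_ge0// /G sqrrN Gn.
    - by rewrite -[X in _ --> X](mulr0 a^-1); apply: cvgM; [exact: cvg_cst|exact: cvg_harmonic].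
  rewrite RintegralB//; last 2 first.
  - exact: (integrableZl measurableT b' (iGcos b')).
  - exact: (integrableZl measurableT (2 * a) (ixGsin b')).
  rewrite (RintegralZl _ measurableT (iGcos b')) (RintegralZl _ measurableT (ixGsin b')).
  move=> /subr0_eq E; apply: (mulfI (_ : 2 * a != 0)).
    by rewrite mulf_neq0// gt_eqF.
  by rewrite -E; field; rewrite gt_eqF.
pose Phi b' := \int[mu]_x (G x * cos (b' * x + c)).
have dPhi b' : is_derive b' 1 Phi (- (b' / (2 * a) * Phi b')).
  pose f b' x := G x * cos (b' * x + c).
  have df x b1 : is_derive b1 1 (f ^~ x) (- (x * G x * sin (b1 * x + c))).
    rewrite /f; apply: is_derive_eq.
    by rewrite /GRing.scale/= !mulr1 ?addr0; ring.
  have d1f b1 x : partial1of2 f b1 x = - (x * G x * sin (b1 * x + c)).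
    by rewrite partial1of2E; exact: derive_val.
  have H1 : forall b1, `]b' - 1, b' + 1[%classic b1 ->
    mu.-integrable setT (EFin \o f b1) by move=> b1 _; exact: iGcos.
  have H2 : forall b1 x, `]b' - 1, b' + 1[%classic b1 -> setT x ->
    derivable (f ^~ x) b1 1 by move=> b1 x _ _; exact: ex_derive.
  have H3 : forall b1 x, `]b' - 1, b' + 1[%classic b1 -> setT x ->
    `|partial1of2 f b1 x| <= `|x| * G x.
    move=> b1 x _ _; rewrite d1f normrN !normrM (ger0_norm (expR_ge0 _)).
    by rewrite ler_piMr ?mulr_ge0 ?expR_ge0// sin_max.
  have G0 x : 0 <= `|x| * G x by rewrite mulr_ge0// expR_ge0.
  have Ib : `]b' - 1, b' + 1[%classic b' by rewrite /= in_itv/=; lra.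
  have iG := integrable_normr_gaussian a0.
  apply: DeriveDef.
    exact: (derivable_under_integral measurableT Ib H1 H2 G0 iG H3).
  rewrite -derive1E (differentiation_under_integral measurableT Ib H1 H2 G0 iG H3).
  under eq_Rintegral do rewrite d1f.
  rewrite -by_parts -mulN1r -(RintegralZl _ measurableT (ixGsin b')).
  by apply: eq_Rintegral => x _; rewrite mulN1r.
(* Phi solves Phi'(b) = - b / (2 a) Phi(b), so H is constant. *)
pose H y := Phi y * expR (y ^+ 2 / (4 * a)).
have dH y : is_derive y 1 H 0.
  rewrite /H; apply: is_derive_eq.
  by rewrite /GRing.scale/= ?mulr1 ?scaler0 ?addr0; field; rewrite gt_eqF.
have := is_derive_0_is_cst b 0 dH.
rewrite /H expr0n/= mul0r expR0 mulr1.
have -> : Phi 0 = Num.sqrt (pi / a) * cos c.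
  rewrite /Phi; under eq_Rintegral do rewrite mul0r add0r.
  rewrite RintegralZr//; last exact: integrable_gaussian0.
  have := @integral_gaussian R a 0 a0; under eq_Rintegral do rewrite subr0.
  by move=> ->.
move=> E; rewrite -[LHS]mulr1 -[in LHS](expR0) -[in LHS](subrr (b ^+ 2 / (4 * a))) expRD.
by rewrite mulrA -/(Phi b) E; ring.
Qed.

End fourier_gaussian.

(** * Integrals of tensor products *)

Section complex_integral.
Context {R : realType}.

Definition cintegrable d (T : measurableType d) (mu : {measure set T -> \bar R})
    (f : T -> R[i]) :=
  mu.-integrable setT (EFin \o (fun x => complex.Re (f x))) /\
  mu.-integrable setT (EFin \o (fun x => complex.Im (f x))).

Definition cint d (T : measurableType d) (mu : {measure set T -> \bar R})
    (f : T -> R[i]) : R[i] :=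
  Complex (\int[mu]_x complex.Re (f x)) (\int[mu]_x complex.Im (f x)).

Section product.
Context d1 d2 (T1 : measurableType d1) (T2 : measurableType d2).
Context (m1 : {sigma_finite_measure set T1 -> \bar R})
        (m2 : {sigma_finite_measure set T2 -> \bar R}).

Lemma integrable_prodM (f : T1 -> R) (g : T2 -> R) :
  m1.-integrable setT (EFin \o f) -> m2.-integrable setT (EFin \o g) ->
  (m1 \x m2)%E.-integrable setT (EFin \o (fun p => f p.1 * g p.2)).
Proof.
move=> intf intg.
have mf : measurable_fun setT f by apply/measurable_EFinP; exact: measurable_int intf.
have mg : measurable_fun setT g by apply/measurable_EFinP; exact: measurable_int intg.
apply/integrable12ltyP.
  apply/measurable_EFinP; apply: measurable_funM.
    exact: measurableT_comp measurable_fst.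
  exact: measurableT_comp measurable_snd.
have /integrableP[_ goo] := intg; have /integrableP[_ foo] := intf.
have E x : (\int[m2]_y `|(EFin \o (fun p : T1 * T2 => f p.1 * g p.2)%R) (x, y)| =
    `|(f x)%:E| * \int[m2]_y `|(EFin \o g) y|)%E.
  rewrite -ge0_integralZl//.
    by apply: eq_integral => y _; rewrite /= normrM EFinM.
  by apply: measurableT_comp => //; exact/measurable_EFinP.
under eq_integral do rewrite E.
rewrite ge0_integralZr//=; last 2 first.
- by apply/measurable_EFinP; exact: measurableT_comp.
- exact: integral_ge0.
by rewrite lte_mul_pinfty ?integral_ge0// ge0_fin_numE ?integral_ge0.
Qed.

Lemma Rintegral_prodM (f : T1 -> R) (g : T2 -> R) :
  m1.-integrable setT (EFin \o f) -> m2.-integrable setT (EFin \o g) ->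
  \int[(m1 \x m2)%E]_p (f p.1 * g p.2) = \int[m1]_x f x * \int[m2]_y g y.
Proof.
move=> intf intg; have intfg := integrable_prodM intf intg.
rewrite [LHS]/Rintegral -(integral12_prod_meas1 intfg) /fubini_F/=.
have E x : (\int[m2]_y (f x * g y)%:E = (f x * \int[m2]_y g y)%R%:E)%E.
  under eq_integral do rewrite EFinM.
  by rewrite integralZl// EFinM fineK//; exact: integrable_fin_num.
under eq_integral do rewrite E.
by rewrite -RintegralZr.
Qed.

Lemma cintegrable_prodM (f : T1 -> R[i]) (g : T2 -> R[i]) :
  cintegrable m1 f -> cintegrable m2 g ->
  cintegrable (m1 \x m2)%E (fun p => f p.1 * g p.2).
Proof.
move=> [fr fi] [gr gi]; split.
- have := integrableB measurableT (integrable_prodM fr gr) (integrable_prodM fi gi).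
  by apply: eq_integrable => // x _; exact: (congr1 EFin (esym (Re_mul (f x.1) (g x.2)))).
- have := integrableD measurableT (integrable_prodM fr gi) (integrable_prodM fi gr).
  by apply: eq_integrable => // x _; exact: (congr1 EFin (esym (Im_mul (f x.1) (g x.2)))).
Qed.

Lemma cint_prodM (f : T1 -> R[i]) (g : T2 -> R[i]) :
  cintegrable m1 f -> cintegrable m2 g ->
  cint (m1 \x m2)%E (fun p => f p.1 * g p.2) = cint m1 f * cint m2 g.
Proof.
move=> [fr fi] [gr gi].
have Er : \int[(m1 \x m2)%E]_p complex.Re (f p.1 * g p.2) =
    complex.Re (cint m1 f * cint m2 g).
  under eq_Rintegral do rewrite Re_mul.
  rewrite (RintegralB measurableT (integrable_prodM fr gr) (integrable_prodM fi gi)).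
  by rewrite (Rintegral_prodM fr gr) (Rintegral_prodM fi gi) Re_mul.
have Ei : \int[(m1 \x m2)%E]_p complex.Im (f p.1 * g p.2) =
    complex.Im (cint m1 f * cint m2 g).
  under eq_Rintegral do rewrite Im_mul.
  rewrite (RintegralD measurableT (integrable_prodM fr gi) (integrable_prodM fi gr)).
  by rewrite (Rintegral_prodM fr gi) (Rintegral_prodM fi gr) Im_mul.
by rewrite [LHS]/cint Er Ei; case: (_ * _).
Qed.

End product.

Lemma integrable_rV_cons n (f : 'rV[R]_n.+1 -> R) :
  measurable_fun setT f ->
  (lebesgue_measure \x lebesgue_rV R n)%E.-integrable setT (EFin \o (f \o @cons_rV R n)) ->
  (lebesgue_rV R n.+1).-integrable setT (EFin \o f) /\
  \int[lebesgue_rV R n.+1]_x f x =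
  \int[(lebesgue_measure \x lebesgue_rV R n)%E]_p f (cons_rV p).
Proof.
move=> /measurable_EFinP mf intf.
have mc := @measurable_cons_rV R n.
split.
  have /integrableP[m1 m2] := integrable_pushforward mc mf intf measurableT.
  by apply/integrableP; split.
rewrite /Rintegral; congr fine.
rewrite -[RHS](integral_pushforward mc mf intf measurableT).
exact: eq_measure_integral.
Qed.

Lemma measurable_tensor n (h : 'I_n -> R -> R[i]) :
  (forall i, measurable_fun setT (fun x => complex.Re (h i x)) /\
             measurable_fun setT (fun x => complex.Im (h i x))) ->
  measurable_fun setT (fun x : 'rV[R]_n => complex.Re (\prod_(i < n) h i (x ord0 i))) /\
  measurable_fun setT (fun x : 'rV[R]_n => complex.Im (\prod_(i < n) h i (x ord0 i))).
Proof.
move=> mh; elim: (index_enum _) => [|i s [IH1 IH2]].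
  by under eq_fun do rewrite big_nil;
    under [X in _ /\ measurable_fun _ X]eq_fun do rewrite big_nil.
under eq_fun do rewrite big_cons Re_mul.
under [X in _ /\ measurable_fun _ X]eq_fun do rewrite big_cons Im_mul.
have [m1 m2] := mh i.
have := measurableT_comp m1 (@measurable_rV_coord R n i).
have := measurableT_comp m2 (@measurable_rV_coord R n i).
by split; [apply: measurable_funB|apply: measurable_funD]; exact: measurable_funM.
Qed.

(** Induction on the dimension: [cons_rV] splits off coordinate 0, Fubini separates it, and in
    dimension 0 the empty product is integrated against a Dirac mass. Integrability is carried along
    because Fubini requires it at the next step. *)
Lemma cintegral_tensor n (h : 'I_n -> R -> R[i]) :
  (forall i, cintegrable lebesgue_measure (h i)) ->
  cintegrable (lebesgue_rV R n) (fun x => \prod_(i < n) h i (x ord0 i)) /\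
  cintegral (fun x : 'rV[R]_n => \prod_(i < n) h i (x ord0 i)) =
  \prod_(i < n) cint lebesgue_measure (h i).
Proof.
elim: n h => [|n IHn] h inth.
  have D (c : \bar R) : (\int[lebesgue_rV R 0]_x c = c)%E.
    have mc : measurable_fun [set: 'rV[R]_0] (cst c) by [].
    by rewrite [LHS](integral_dirac (0 : 'rV[R]_0) measurableT mc) diracT mul1e.
  have ic (c : R) : (lebesgue_rV R 0).-integrable setT (EFin \o cst c).
    apply/integrableP; split; first exact/measurable_EFinP/measurable_cst.
    by apply: le_lt_trans (ltry `|c|); rewrite -[leRHS]D.
  split.
    by split; [apply: (eq_integrable measurableT _ _ _ (ic (complex.Re 1)))|
      apply: (eq_integrable measurableT _ _ _ (ic (complex.Im 1)))] => x _ /=;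
      rewrite big_ord0.
  rewrite big_ord0 /cintegral.
  under eq_Rintegral do rewrite big_ord0.
  under [X in Complex _ X]eq_Rintegral do rewrite big_ord0.
  by rewrite /Rintegral !D.
have [IH1 IH2] := IHn (fun i => h (lift ord0 i)) (fun i => inth _).
have mh i : measurable_fun setT (fun x => complex.Re (h i x)) /\
             measurable_fun setT (fun x => complex.Im (h i x)).
  by have [i1 i2] := inth i; split; apply/measurable_EFinP;
     [exact: measurable_int i1|exact: measurable_int i2].
have [mr mi] := measurable_tensor mh.
have E p : \prod_(i < n.+1) h i (@cons_rV R n p ord0 i) =
    h ord0 p.1 * (fun x : 'rV[R]_n => \prod_(i < n) h (lift ord0 i) (x ord0 i)) p.2.
  rewrite big_ord_recl /cons_rV mxE unlift_none/=; congr (_ * _).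
  by apply: eq_bigr => i _; rewrite mxE liftK.
have [c1 c2] := cintegrable_prodM (inth ord0) IH1.
have [r1 r2] := integrable_rV_cons mr
  (eq_integrable measurableT _ _ (fun p _ => congr1 (fun z => (complex.Re z)%:E) (esym (E p))) c1).
have [i1 i2] := integrable_rV_cons mi
  (eq_integrable measurableT _ _ (fun p _ => congr1 (fun z => (complex.Im z)%:E) (esym (E p))) c2).
split; first by split.
rewrite /cintegral r2 i2; under eq_Rintegral do rewrite E.
under [X in Complex _ X]eq_Rintegral do rewrite E.
rewrite big_ord_recl -IH2; exact: (cint_prodM (inth ord0) IH1).
Qed.

End complex_integral.

(** * Wave packets *)

Section wave_packets.
Context {R : realType}.
Notation mu := (@lebesgue_measure R).
Local Notation "x %:C" := (Complex x 0).

Lemma cint_sum d (T : measurableType d) (m : {measure set T -> \bar R})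
    n (F : 'I_n -> T -> R[i]) :
  (forall i, cintegrable m (F i)) ->
  cintegrable m (fun x => \sum_(i < n) F i x) /\
  cint m (fun x => \sum_(i < n) F i x) = \sum_(i < n) cint m (F i).
Proof.
move=> intF; elim: (index_enum _) => [|i s [[r1 i1] IH2]].
  split; first by split; under eq_fun do rewrite /= big_nil; exact: integrable0.
  rewrite big_nil /cint; under eq_Rintegral do rewrite big_nil.
  under [X in Complex _ X]eq_Rintegral do rewrite big_nil.
  by rewrite /Rintegral !integral0.
have [r2 i2] := intF i.
have Hr := integrableD measurableT r2 r1.
have Hi := integrableD measurableT i2 i1.
split.
  split; [apply: (eq_integrable measurableT _ _ _ Hr)|
          apply: (eq_integrable measurableT _ _ _ Hi)] => x _ /=.
  - by rewrite big_cons ReD.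
  - by rewrite big_cons ImD.
rewrite big_cons -IH2 /cint; under eq_Rintegral do rewrite big_cons ReD.
under [X in Complex _ X]eq_Rintegral do rewrite big_cons ImD.
by rewrite (RintegralD measurableT r2 r1) (RintegralD measurableT i2 i1).
Qed.

Definition packet (W xi y : R) : R[i] :=
  (expR (- (pi / W ^+ 2 * y ^+ 2)))%:C * cis (2 * pi * xi * y).

(** This is the Fourier transform of [packet W xi]: of mass 1, concentrated at scale [1 / W] around
    [xi], and nonnegative, so that only the phases can cause cancellation. *)
Definition packet_hat (W xi z : R) : R := W * expR (- (pi * W ^+ 2 * (z - xi) ^+ 2)).

Lemma packet_fourier (W xi z : R) : 0 < W ->
  cintegrable mu (fun y => packet W xi y * cis (- (2 * pi * (y * z)))) /\
  cint mu (fun y => packet W xi y * cis (- (2 * pi * (y * z)))) = (packet_hat W xi z)%:C.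
Proof.
move=> W0; set a := pi / W ^+ 2; set b := 2 * pi * (xi - z).
have a0 : 0 < a by rewrite divr_gt0 ?pi_gt0 ?exprn_gt0.
have E y : packet W xi y * cis (- (2 * pi * (y * z))) =
    Complex (expR (- (a * y ^+ 2)) * cos (b * y + 0))
            (expR (- (a * y ^+ 2)) * cos (b * y + - (pi / 2))).
  rewrite /packet -mulrA -cisD mulr_cis cosBpihalf addr0.
  by rewrite (_ : _ + _ = b * y)// /b; ring.
have icos c : mu.-integrable setT (fun y => (expR (- (a * y ^+ 2)) * cos (b * y + c))%:E).
  apply: (@integrable_bounded_mulr _ _ _ 1); first exact: integrable_gaussian0.
  - apply: continuous_measurable_fun => x.
    apply: continuous_comp; last exact: continuous_cos.
    by apply: cvgD; [apply: cvgM; [exact: cvg_cst|exact: cvg_id]|exact: cvg_cst].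
  - by move=> x; exact: cos_max.
split.
  split; [apply: (eq_integrable measurableT _ _ _ (icos 0))|
          apply: (eq_integrable measurableT _ _ _ (icos (- (pi / 2))))] => y _.
  - exact: (congr1 (fun z => (complex.Re z)%:E) (esym (E y))).
  - exact: (congr1 (fun z => (complex.Im z)%:E) (esym (E y))).
rewrite /cint; under eq_Rintegral do rewrite E /=.
under [X in Complex _ X]eq_Rintegral do rewrite E /=.
rewrite !fourier_gaussian_cos// cos0 cosN cos_pihalf mulr0 mulr1.
rewrite /packet_hat; congr (Complex (_ * expR _) _).
  rewrite /a invf_div mulrC divfK ?gt_eqF ?pi_gt0//.
  by rewrite sqrtr_sqr ger0_norm ?ltW.
have p0 : pi != 0 :> R by rewrite gt_eqF ?pi_gt0.
have W1 : W != 0 by rewrite gt_eqF.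
by rewrite /a /b; move: (pi : R) p0 => p p0; field; rewrite p0 W1.
Qed.

Lemma packet_hat_ge0 (W xi z : R) : 0 < W -> 0 <= packet_hat W xi z.
Proof. by move=> W0; rewrite mulr_ge0 ?expR_ge0// ltW. Qed.

Lemma integrable_packet_hat (W xi : R) : 0 < W ->
  mu.-integrable setT (EFin \o packet_hat W xi).
Proof.
move=> W0; have a0 : 0 < pi * W ^+ 2 by rewrite mulr_gt0 ?pi_gt0 ?exprn_gt0.
exact: (integrableZl measurableT W (integrable_gaussian xi a0)).
Qed.

Lemma Rintegral_packet_hat (W xi : R) : 0 < W ->
  \int[mu]_z packet_hat W xi z = 1.
Proof.
move=> W0; have a0 : 0 < pi * W ^+ 2 by rewrite mulr_gt0 ?pi_gt0 ?exprn_gt0.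
rewrite /packet_hat (RintegralZl _ measurableT (integrable_gaussian xi a0)).
rewrite integral_gaussian// invfM mulrA divff ?gt_eqF ?pi_gt0// mul1r.
by rewrite -exprVn sqrtr_sqr ger0_norm ?invr_ge0 ?ltW// divff ?gt_eqF.
Qed.

Lemma cintegrable_packet_hat (W xi : R) (phi : R -> R) : 0 < W -> continuous phi ->
  cintegrable mu (fun z => (packet_hat W xi z)%:C * cis (phi z)).
Proof.
move=> W0 cphi.
have Hcos : mu.-integrable setT (fun z => (packet_hat W xi z * cos (phi z))%:E).
  apply: (@integrable_bounded_mulr _ _ _ 1); first exact: integrable_packet_hat.
  - apply: continuous_measurable_fun => x.
    by apply: continuous_comp; [exact: cphi|exact: continuous_cos].
  - by move=> x; exact: cos_max.
have Hsin : mu.-integrable setT (fun z => (packet_hat W xi z * sin (phi z))%:E).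
  apply: (@integrable_bounded_mulr _ _ _ 1); first exact: integrable_packet_hat.
  - apply: continuous_measurable_fun => x.
    by apply: continuous_comp; [exact: cphi|exact: continuous_sin].
  - by move=> x; exact: sin_max.
split; [apply: (eq_integrable measurableT _ _ _ Hcos)|
        apply: (eq_integrable measurableT _ _ _ Hsin)] => z _.
- exact: (congr1 (fun z => (complex.Re z)%:E) (esym (mulr_cis _ _))).
- exact: (congr1 (fun z => (complex.Im z)%:E) (esym (mulr_cis _ _))).
Qed.

Variables (n N : nat) (W : R) (xi : 'I_n -> 'I_N -> R).
Hypothesis W0 : 0 < W.

Definition packet_sum (x : 'rV[R]_n) : R[i] :=
  \prod_(j < n) \sum_(k < N) packet W (xi j k) (x ord0 j).

Definition packet_sum_hat (j : 'I_n) (z : R) : R := \sum_(k < N) packet_hat W (xi j k) z.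

Lemma fourier_packet_sum z :
  fourier packet_sum z = \prod_(j < n) (packet_sum_hat j (z ord0 j))%:C.
Proof.
have S1 j := cint_sum (fun k => proj1 (packet_fourier (xi j k) (z ord0 j) W0)).
have E x : packet_sum x * cis (- (2 * pi * dot x z)) =
    \prod_(j < n) \sum_(k < N) (packet W (xi j k) (x ord0 j) *
      cis (- (2 * pi * (x ord0 j * z ord0 j)))).
  rewrite /dot mulr_sumr -sumrN cis_sum -big_split/=.
  by apply: eq_bigr => j _; rewrite mulr_suml.
rewrite /fourier; under eq_fun do rewrite E.
have [_ ->] := cintegral_tensor (fun j => proj1 (S1 j)).
apply: eq_bigr => j _; rewrite (S1 j).2 /packet_sum_hat -sum_real_complex.
by apply: eq_bigr => k _; rewrite (packet_fourier _ _ W0).2.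
Qed.

(** The free evolution of the [j]-th factor, kept as an integral over frequencies because the lower
    bound estimates the phase under the integral sign. *)
Definition evolution t (j : 'I_n) (y : R) : R[i] :=
  \sum_(k < N) cint mu (fun z => (packet_hat W (xi j k) z)%:C *
    cis (2 * pi * (y * z) - 4 * pi ^+ 2 * t * (z * z))).

Lemma schroedinger_packet_sum t x :
  schroedinger t packet_sum x = \prod_(j < n) evolution t j (x ord0 j).
Proof.
pose phi j z := 2 * pi * (x ord0 j * z) - 4 * pi ^+ 2 * t * (z * z).
have cphi j : continuous (phi j).
  move=> z; apply: cvgB; (apply: cvgM; first exact: cvg_cst); apply: cvgM;
    by [exact: cvg_cst|exact: cvg_id].
have S1 j := cint_sum (fun k => @cintegrable_packet_hat W (xi j k) _ W0 (cphi j)).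
have E z : fourier packet_sum z * cis (2 * pi * dot x z - 4 * pi ^+ 2 * t * dot z z) =
    \prod_(j < n) \sum_(k < N) ((packet_hat W (xi j k) (z ord0 j))%:C *
      cis (phi j (z ord0 j))).
  rewrite fourier_packet_sum /dot !mulr_sumr -sumrB cis_sum -big_split/=.
  by apply: eq_bigr => j _; rewrite -sum_real_complex mulr_suml.
rewrite /schroedinger; under eq_fun do rewrite E.
have [_ ->] := cintegral_tensor (fun j => proj1 (S1 j)).
by apply: eq_bigr => j _; rewrite (S1 j).2.
Qed.

End wave_packets.

(** * Tensor products of Gaussians are Schwartz functions *)

Section schwartz_tensor.
Context {R : realType}.
Implicit Types (u v : R -> R[i]).

(** Finite sums of [y^k exp (- a y^2) (p + i q) exp (i b y)], written in real and imaginary parts.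
    The class contains the packets and is stable under differentiation, and one fixed [a] governs
    the decay of all its members. *)
Inductive gauss_poly (a : R) : (R -> R[i]) -> Prop :=
| gauss_poly0 : gauss_poly a (fun=> 0)
| gauss_poly_monomial k (p q b : R) : gauss_poly a (fun y =>
    Complex (y ^+ k * expR (- (a * y ^+ 2)) * (p * cos (b * y) - q * sin (b * y)))
            (y ^+ k * expR (- (a * y ^+ 2)) * (p * sin (b * y) + q * cos (b * y))))
| gauss_polyD u v : gauss_poly a u -> gauss_poly a v -> gauss_poly a (fun y => u y + v y).

Definition cderivative u v := forall y : R,
  is_derive y 1 (fun z => complex.Re (u z)) (complex.Re (v y)) /\
  is_derive y 1 (fun z => complex.Im (u z)) (complex.Im (v y)).

#[local] Instance is_derive_exprn k (y : R) :
  is_derive y 1 (fun z : R => z ^+ k) (k%:R * y ^+ k.-1).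
Proof.
have /= := is_deriveX k (is_derive_id y (1 : R)); rewrite /GRing.scale/= mulr1.
by congr is_derive; apply/funext => z; rewrite fctE.
Qed.

Lemma gauss_poly_derivative a u : gauss_poly a u ->
  exists2 v, gauss_poly a v & cderivative u v.
Proof.
elim=> [|k p q b|{}u v _ [u' gu du] _ [v' gv dv]].
- by exists (fun=> 0); [exact: gauss_poly0|split; exact: is_derive_cst].
(* The product rule gives three terms, from the power, the Gaussian and the oscillation. For [k = 0]
   the truncated [k.-1] is harmless, since its coefficient [k%:R] vanishes. *)
- eexists.
    apply: gauss_polyD; first exact: (gauss_poly_monomial a k.-1 (k%:R * p) (k%:R * q) b).
    apply: gauss_polyD; first exact: (gauss_poly_monomial a k.+1 (- 2 * a * p) (- 2 * a * q) b).
    exact: (gauss_poly_monomial a k (- b * q) (b * p) b).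
  move=> y; split; rewrite /= ?ReD ?ImD /=; apply: is_derive_eq;
  by rewrite /GRing.scale/= ?mulr1 ?mulr0 ?addr0 (exprS y k) ?expr1; ring.
- exists (fun y => u' y + v' y); first exact: gauss_polyD.
  move=> y; have [u1 u2] := du y; have [v1 v2] := dv y; split.
  + under eq_fun do rewrite ReD; rewrite ReD; exact: is_deriveD.
  + under eq_fun do rewrite ImD; rewrite ImD; exact: is_deriveD.
Qed.

(** Each power of [y] is paid for with half of the exponent, hence an induction hypothesis valid for
    every [a]. *)
Lemma monomial_gaussian_bounded (a : R) m : 0 < a ->
  exists M, forall y : R, `|y ^+ m| * expR (- (a * y ^+ 2)) <= M.
Proof.
elim: m a => [|m IH] a a0.
  exists 1 => y; rewrite expr0 normr1 mul1r -[leRHS]expR0 ler_expR oppr_le0.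
  by rewrite mulr_ge0 ?sqr_ge0// ltW.
have a20 : 0 < a / 2 by rewrite divr_gt0.
have [M HM] := IH _ a20.
exists ((1 + 2 / (a / 2)) * M) => y.
rewrite (_ : a * y ^+ 2 = a / 2 * y ^+ 2 + a / 2 * y ^+ 2); last by field.
rewrite opprD expRD exprS normrM mulrACA ler_pM// ?mulr_ge0 ?expR_ge0//.
apply: (le_trans (normr_gaussian_le _ a20)).
have k0 : 0 < 1 + 2 / (a / 2) by rewrite addr_gt0// divr_gt0.
rewrite ler_piMr ?(ltW k0)// -[leRHS]expR0 ler_expR oppr_le0.
by rewrite mulr_ge0 ?sqr_ge0// ltW// divr_gt0.
Qed.

Lemma gauss_poly_bounded a u m : 0 < a -> gauss_poly a u ->
  exists M, forall y, `|y ^+ m| * Normc.normc (u y) <= M.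
Proof.
move=> a0; elim=> [|k p q b|{}u v _ [M HM] _ [M' HM']].
- by exists 0 => y; rewrite Normc.normc0 mulr0.
- have [M HM] := monomial_gaussian_bounded (m + k) a0.
  exists (M * (2 * (`|p| + `|q|))) => y.
  apply: (@le_trans _ _ (`|y ^+ m| * (`|y ^+ k| * expR (- (a * y ^+ 2)) *
    (2 * (`|p| + `|q|))))).
    rewrite ler_wpM2l//; apply: le_trans (normc_le _ _) _.
    rewrite !normrM (ger0_norm (expR_ge0 _)) -mulrDr ler_wpM2l ?mulr_ge0 ?expR_ge0//.
    rewrite mulr_natl mulr2n lerD//.
      apply: le_trans (ler_normB _ _) _.
      by rewrite !normrM lerD// ler_piMr ?cos_max ?sin_max.
    apply: le_trans (ler_normD _ _) _.
    by rewrite !normrM lerD// ler_piMr ?cos_max ?sin_max.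
  rewrite mulrA [X in X * _]mulrA -normrM -exprD; apply: ler_wpM2r; last exact: HM.
  by rewrite mulr_ge0 ?addr_ge0.
- exists (M + M') => y; apply: le_trans (lerD (HM y) (HM' y)).
  by rewrite -mulrDr ler_wpM2l// le_normcD.
Qed.

(** A derivative along [e] sees only the restriction of [f] to the line through [x] in that
    direction, which reduces partial derivatives to one-variable calculus. *)
Lemma is_derive_line (V : normedModType R) (f : V -> R) (g : R -> R) (x e : V) (y d : R) :
  (forall h : R, f (h *: e + x) = g (h *: 1 + y)) ->
  is_derive y 1 g d -> is_derive x e f d.
Proof.
move=> fg [dg Dg].
have fx : f x = g y by have := fg 0; rewrite !scale0r !add0r.
have E : (fun h : R => h^-1 *: ((f \o shift x) (h *: e) - f x)) =
         (fun h : R => h^-1 *: ((g \o shift y) (h *: 1) - g y)).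
  by apply/funext => h; rewrite /= fx fg.
by split; [rewrite /derivable E|rewrite -Dg /derive E].
Qed.

Section tensor.
Variable n : nat.

Definition tensor (u : 'I_n -> R -> R[i]) (x : 'rV[R]_n) : R[i] :=
  \prod_(j < n) u j (x ord0 j).

Lemma is_derive_tensor (u : 'I_n -> R -> R[i]) i v x : cderivative (u i) v ->
  let d := tensor (fun j => if j == i then v else u j) x in
  is_derive x (delta_mx ord0 i) (re_part (tensor u)) (complex.Re d) /\
  is_derive x (delta_mx ord0 i) (im_part (tensor u)) (complex.Im d).
Proof.
move=> /(_ (x ord0 i))[du1 du2] d.
pose c := \prod_(j < n | j != i) u j (x ord0 j).
have dE : d = v (x ord0 i) * c.
  rewrite /d /tensor (bigD1 i)//= eqxx; congr (_ * _).
  by apply: eq_bigr => j /negbTE ->.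
have uE h : tensor u (h *: delta_mx ord0 i + x) = u i (h *: 1 + x ord0 i) * c.
  rewrite /tensor (bigD1 i)//= !mxE !eqxx; congr (_ * _).
  by apply: eq_bigr => j /negbTE ji; rewrite !mxE ji andbF mulr0 add0r.
split.
- apply: (@is_derive_line _ _ (fun y => complex.Re (u i y) * complex.Re c -
    complex.Im (u i y) * complex.Im c) _ _ (x ord0 i)).
    by move=> h; rewrite /re_part uE Re_mul.
  apply: is_derive_eq; rewrite dE Re_mul /GRing.scale/= !mulr0 !add0r.
  by rewrite ![complex.Re c * _]mulrC ![complex.Im c * _]mulrC.
- apply: (@is_derive_line _ _ (fun y => complex.Re (u i y) * complex.Im c +
    complex.Im (u i y) * complex.Re c) _ _ (x ord0 i)).
    by move=> h; rewrite /im_part uE Im_mul.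
  apply: is_derive_eq; rewrite dE Im_mul /GRing.scale/= !mulr0 !add0r.
  by rewrite ![complex.Re c * _]mulrC ![complex.Im c * _]mulrC.
Qed.

Lemma continuous_tensor (u : 'I_n -> R -> R[i]) :
  (forall j, continuous (fun y => complex.Re (u j y)) /\
             continuous (fun y => complex.Im (u j y))) ->
  continuous (re_part (tensor u)) /\ continuous (im_part (tensor u)).
Proof.
move=> cu; rewrite /re_part /im_part /tensor.
elim: (index_enum _) => [|i s [IH1 IH2]].
  under eq_fun do rewrite big_nil; under [X in _ /\ continuous X]eq_fun do rewrite big_nil.
  by split; exact: cst_continuous.
have [c1 c2] := cu i.
have cc (f : R -> R) : continuous f -> continuous (fun x : 'rV[R]_n => f (x ord0 i)).
  by move=> cf x; apply: continuous_comp; [exact: coord_continuous|exact: cf].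
under eq_fun do rewrite big_cons Re_mul.
under [X in _ /\ continuous X]eq_fun do rewrite big_cons Im_mul.
split=> x.
- exact: (cvgB (cvgM (cc _ c1 x) (IH1 x)) (cvgM (cc _ c2 x) (IH2 x))).
- exact: (cvgD (cvgM (cc _ c1 x) (IH2 x)) (cvgM (cc _ c2 x) (IH1 x))).
Qed.

(** A partial derivative replaces one factor by its derivative, so every iterated one is again a
    tensor with factors in [gauss_poly a]. Continuity, derivability and the decay bounds then follow
    factor by factor. *)
Lemma schwartz_tensor (a : R) (u : 'I_n -> R -> R[i]) : 0 < a ->
  (forall j, gauss_poly a (u j)) -> schwartz (tensor u).
Proof.
move=> a0 gu.
have P b : exists2 w, (forall j, gauss_poly a (w j)) & partials b (tensor u) = tensor w.
  elim: b => [|i b [w gw /= ->]]; first by exists u.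
  have [v gv dv] := gauss_poly_derivative (gw i).
  exists (fun j => if j == i then v else w j); first by move=> j; case: ifP.
  apply/funext => x; have [d1 d2] := is_derive_tensor x dv.
  rewrite /partial !derive_val.
  by case: (tensor _ _).
have C w : (forall j, gauss_poly a (w j)) -> forall j,
    continuous (fun y => complex.Re (w j y)) /\ continuous (fun y => complex.Im (w j y)).
  move=> gw j; have [v _ dv] := gauss_poly_derivative (gw j).
  by split=> y; have [d1 d2] := dv y; apply: differentiable_continuous;
    apply/derivable1_diffP; exact: ex_derive.
split=> [b|e b]; have [w gw ->] := P b.
  have [c1 c2] := continuous_tensor (C _ w gw).
  split=> // i x; have [v _ dv] := gauss_poly_derivative (gw i).
  by have [d1 d2] := is_derive_tensor x dv; split; exact: ex_derive.
have /choice[M HM] := fun j => gauss_poly_bounded (e j) a0 (gw j).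
exists (\prod_(j < n) M j) => x.
rewrite normr_prod /tensor normc_prod -big_split/=.
apply: ler_prod => j _; rewrite HM andbT mulr_ge0//.
exact: normc_ge0.
Qed.

End tensor.

Lemma gauss_poly_sum a N (F : 'I_N -> R -> R[i]) :
  (forall k, gauss_poly a (F k)) -> gauss_poly a (fun y => \sum_(k < N) F k y).
Proof.
move=> gF; elim: (index_enum _) => [|i s IH].
  by under eq_fun do rewrite big_nil; exact: gauss_poly0.
by under eq_fun do rewrite big_cons; exact: gauss_polyD.
Qed.

Lemma schwartz_packet_sum n N W (xi : 'I_n -> 'I_N -> R) : 0 < W ->
  schwartz (packet_sum W xi).
Proof.
move=> W0; apply: (@schwartz_tensor n (pi / W ^+ 2)
  (fun j y => \sum_(k < N) packet W (xi j k) y)).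
  by rewrite divr_gt0 ?pi_gt0 ?exprn_gt0.
move=> j; apply: gauss_poly_sum => k.
rewrite (_ : packet _ _ = fun y => Complex
   (y ^+ 0 * expR (- (pi / W ^+ 2 * y ^+ 2)) *
     (1 * cos (2 * pi * xi j k * y) - 0 * sin (2 * pi * xi j k * y)))
   (y ^+ 0 * expR (- (pi / W ^+ 2 * y ^+ 2)) *
     (1 * sin (2 * pi * xi j k * y) + 0 * cos (2 * pi * xi j k * y)))).
  exact: gauss_poly_monomial.
by apply/funext => y; rewrite /packet mulr_cis expr0 !mul1r !mul0r subr0 addr0.
Qed.

End schwartz_tensor.

(** * Lower bound for the maximal function *)

Section digits.
Context {R : realType}.

(** Modulo 1, [m / Q^(j+1)] depends only on the digits 0 to [j] of [m], and digit [j] moves it in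
    steps of [1 / Q]. The digits can thus be chosen one after the other, later ones leaving the
    earlier conditions intact. *)
Lemma simultaneous_digits (Q n : nat) (y : nat -> R) : (0 < Q)%N ->
  exists2 m : nat, (m < Q ^ n)%N & forall j, (j < n)%N -> exists z : int,
    `|y j - m%:R / Q%:R ^+ j.+1 - z%:~R| <= Q%:R^-1.
Proof.
move=> Q0; have q0 : 0 < Q%:R :> R by rewrite ltr0n.
elim: n => [|n [m mQ IH]]; first by exists 0%N.
(* Division of [p] by [Q] yields both unknowns: the remainder is the new digit, the quotient is the
   integer [z]. The rounding error of the floor, divided by [Q], is the final error. *)
set p := Num.floor (Q%:R * (y n - m%:R / Q%:R ^+ n.+1)).
set d := `|(p %% Q)%Z|%N.
have Qz : Q%:Z != 0 by rewrite eqz_nat -lt0n.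
have dE : d%:Z = (p %% Q)%Z by rewrite gez0_abs// modz_ge0.
have dQ : (d < Q)%N by rewrite -ltz_nat dE ltz_pmod.
exists (m + d * Q ^ n)%N.
  rewrite expnS; apply: (@leq_trans (Q ^ n + d * Q ^ n)); first by rewrite ltn_add2r.
  by rewrite -mulSn leq_mul2r dQ orbT.
move=> j; rewrite ltnS leq_eqVlt => /predU1P[->|jn]; last first.
  have [z Hz] := IH j jn; exists (z - (d * Q ^ (n - j.+1))%:Z).
  suff E : (m + d * Q ^ n)%:R / Q%:R ^+ j.+1 =
           m%:R / Q%:R ^+ j.+1 + (d * Q ^ (n - j.+1))%:R :> R.
    rewrite E intrB -pmulrn opprB opprD addrA.
    by rewrite [X in `|X|](_ : _ = y j - m%:R / Q%:R ^+ j.+1 - z%:~R)//; ring.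
  rewrite natrD mulrDl; congr (_ + _).
  rewrite -{1}(subnK jn) expnD mulnA natrM -[Q%:R ^+ _]natrX mulfK//.
  by rewrite pnatr_eq0 -lt0n expn_gt0 Q0.
exists (p %/ Q)%Z.
have pE : p%:~R = (p %/ Q)%Z%:~R * Q%:R + d%:R :> R.
  by rewrite {1}(divz_eq p Q) -dE intrD intrM.
have /andP[f1 f2] : p%:~R <= Q%:R * (y n - m%:R / Q%:R ^+ n.+1) < p%:~R + 1.
  by have := floor_itv (Q%:R * (y n - m%:R / Q%:R ^+ n.+1)); rewrite intrD.
have -> : y n - (m + d * Q ^ n)%:R / Q%:R ^+ n.+1 - (p %/ Q)%Z%:~R =
    (Q%:R * (y n - m%:R / Q%:R ^+ n.+1) - p%:~R) / Q%:R.
  rewrite pE natrD natrM natrX exprS; field.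
  by rewrite expf_neq0 ?gt_eqF.
rewrite ger0_norm; last by rewrite divr_ge0 ?(ltW q0)// subr_ge0.
by rewrite ler_pdivrMr// mulVf ?gt_eqF// lerBlDl ltW.
Qed.

(* A zero integer is replaced by [Q ^ n], which has the same residues. *)
Lemma simultaneous_positive_digits (Q n : nat) (y : nat -> R) : (0 < Q)%N ->
  exists2 m : nat, (0 < m <= Q ^ n)%N & forall j, (j < n)%N -> exists z : int,
    `|y j - m%:R / Q%:R ^+ j.+1 - z%:~R| <= Q%:R^-1.
Proof.
move=> Q0; have q0 : 0 < Q%:R :> R by rewrite ltr0n.
have [[|m] mQ Hm] := simultaneous_digits n y Q0; last by exists m.+1 => //; exact: ltnW.
exists (Q ^ n)%N; first by rewrite expn_gt0 Q0 leqnn.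
move=> j jn; have [z] := Hm j jn; rewrite mul0r subr0 => Hz.
exists (z - (Q ^ (n - j.+1))%:Z).
rewrite -{1}(subnK jn) expnD natrM -[Q%:R ^+ _]natrX mulfK ?natrX ?expf_neq0 ?gt_eqF//.
by rewrite intrB -pmulrn natrX opprB addrA subrK.
Qed.

End digits.

(** * Phases of the packets at a focusing time *)

Section phase.
Context {R : realType}.
Notation mu := (@lebesgue_measure R).
Local Notation "x %:C" := (Complex x 0).

Lemma pi_le4 : pi <= 4 :> R.
Proof. by have [/andP[_]] := @pihalf_02_cos_pihalf R; lra. Qed.

Lemma cosDint (x : R) (k : int) : cos (x + 2 * pi * k%:~R) = cos x.
Proof.
have E : 2 * pi = pi *+ 2 :> R by rewrite mulr_natl.
case: k => n; first by rewrite E mulr_natr (periodicn (@cosD2pi R)).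
rewrite NegzE -[LHS](periodicn (@cosD2pi R) n.+1) -E intrN mulrN -pmulrn.
by congr cos; rewrite -mulr_natr; ring.
Qed.

Lemma cos_ge1B (x : R) : 1 - `|x| <= cos x.
Proof.
rewrite -cos_norm; have := normr_ge0 x; move: `|x| => {}x x0.
have [c _] : exists2 c, c \in `[0, x]%R & cos x - cos 0 = (- sin c) * (x - 0).
  apply: (@MVT_segment _ _ (fun z => - sin z)) => //.
  by apply: continuous_subspaceT; exact: continuous_cos.
by rewrite cos0 subr0; have := sin_max c; rewrite ler_norml => /andP[? ?]; nra.
Qed.

(** Half of the exponent absorbs [q = (W (z - xi))^2], because [q <= exp (pi q / 2)]. The second
    moment is thereby controlled by a wider Gaussian, whose integral [sqrt 2] is explicit. *)
Lemma packet_hat_moment (W xi z : R) : 0 < W ->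
  (W * (z - xi)) ^+ 2 * packet_hat W xi z <=
  W * expR (- (pi * W ^+ 2 / 2 * (z - xi) ^+ 2)).
Proof.
move=> W0; rewrite /packet_hat.
set q := (W * (z - xi)) ^+ 2; have q0 : 0 <= q by exact: sqr_ge0.
have -> : pi * W ^+ 2 * (z - xi) ^+ 2 = pi * q / 2 + pi * q / 2.
  by rewrite /q exprMn; move: (pi : R) => p; field.
have -> : pi * W ^+ 2 / 2 * (z - xi) ^+ 2 = pi * q / 2.
  by rewrite /q exprMn; move: (pi : R) => p; field.
rewrite opprD expRD mulrCA ler_pM2l// mulrA ler_piMl ?expR_ge0//.
rewrite expRN ler_pdivrMr ?expR_gt0// mul1r (le_trans _ (expR_ge1Dx _))//.
by have := @pi_ge2 R; nra.
Qed.

Lemma integrable_gaussian_half (W xi : R) : 0 < W ->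
  mu.-integrable setT (fun z => (W * expR (- (pi * W ^+ 2 / 2 * (z - xi) ^+ 2)))%:E).
Proof.
move=> W0; have a0 : 0 < pi * W ^+ 2 / 2.
  by rewrite divr_gt0// mulr_gt0 ?pi_gt0 ?exprn_gt0.
exact: (integrableZl measurableT W (integrable_gaussian xi a0)).
Qed.

Lemma integral_gaussian_half (W xi : R) : 0 < W ->
  \int[mu]_z (W * expR (- (pi * W ^+ 2 / 2 * (z - xi) ^+ 2))) <= 2.
Proof.
move=> W0; have a0 : 0 < pi * W ^+ 2 / 2.
  by rewrite divr_gt0// mulr_gt0 ?pi_gt0 ?exprn_gt0.
rewrite (RintegralZl W measurableT (integrable_gaussian xi a0)) integral_gaussian//.
have -> : pi / (pi * W ^+ 2 / 2) = 2 * W^-1 ^+ 2.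
  have p0 : pi != 0 :> R by rewrite gt_eqF ?pi_gt0.
  by move: (pi : R) p0 => p p0; field; rewrite p0 gt_eqF.
rewrite sqrtrM// sqrtr_sqr ger0_norm ?invr_ge0 ?(ltW W0)// mulrCA divff ?gt_eqF// mulr1.
by rewrite -ler_sqr ?nnegrE// sqr_sqrtr//; lra.
Qed.

(** The pointwise hypothesis is integrated against a density of mass 1 whose second moment in
    [W (z - xi)] is at most 2, which leaves at least [85/100 - 4/100]. The quadratic loss
    accommodates the frequencies far from [xi], where the phase is uncontrolled. *)
Lemma cos_phase_lower_bound (W xi c : R) (phi : R -> R) : 0 < W ->
  continuous phi ->
  (forall z, 85/100 - 2/100 * (W * (z - xi)) ^+ 2 <= cos (phi z - c)) ->
  2^-1 <= complex.Re (cis (- c) * cint mu (fun z => (packet_hat W xi z)%:C * cis (phi z))).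
Proof.
move=> W0 cphi Hcos.
have [i1 i2] := cintegrable_packet_hat xi W0 cphi.
have E : complex.Re (cis (- c) * cint mu (fun z => (packet_hat W xi z)%:C * cis (phi z))) =
    \int[mu]_z (packet_hat W xi z * cos (phi z - c)).
  rewrite Re_mul /cint/cis [complex.Re _]/= [complex.Im _]/= sinN cosN mulNr opprK.
  rewrite -(RintegralZl _ measurableT i1) -(RintegralZl _ measurableT i2) -RintegralD//.
  - apply: eq_Rintegral => z _; rewrite mulr_cis/= cosB; ring.
  - exact: (integrableZl measurableT _ i1).
  - exact: (integrableZl measurableT _ i2).
have iph := integrable_packet_hat xi W0.
have ig := integrable_gaussian_half xi W0.
have iL1 : mu.-integrable setT (fun z => (85/100 * packet_hat W xi z)%:E).
  exact: (integrableZl measurableT (85/100) iph).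
have iL2 : mu.-integrable setT
    (fun z => (2/100 * (W * expR (- (pi * W ^+ 2 / 2 * (z - xi) ^+ 2))))%:E).
  exact: (integrableZl measurableT (2/100) ig).
have ic : mu.-integrable setT (fun z => (packet_hat W xi z * cos (phi z - c))%:E).
  apply: (@integrable_bounded_mulr _ _ _ 1) => //.
  - apply: continuous_measurable_fun => x.
    apply: continuous_comp; last exact: continuous_cos.
    by apply: cvgB; [exact: cphi|exact: cvg_cst].
  - by move=> x; exact: cos_max.
rewrite E; apply: (@le_trans _ _ (\int[mu]_z (85/100 * packet_hat W xi z -
    2/100 * (W * expR (- (pi * W ^+ 2 / 2 * (z - xi) ^+ 2)))))).
  rewrite (RintegralB measurableT iL1 iL2) (RintegralZl _ measurableT iph).
  rewrite (RintegralZl _ measurableT ig) Rintegral_packet_hat//.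
  by have := integral_gaussian_half xi W0; lra.
apply: le_Rintegral => //.
  by have := integrableB measurableT iL1 iL2; apply: eq_integrable.
move=> z _; have := packet_hat_moment xi z W0; have := packet_hat_ge0 xi z W0.
by have := Hcos z; nra.
Qed.

End phase.

Section evolution_bound.
Context {R : realType}.
Notation mu := (@lebesgue_measure R).
Local Notation "x %:C" := (Complex x 0).

(* [c] is the part of the phase at the frequency [xi] that does not depend on [k]. *)
Lemma phase_bound (N m k : nat) (L Th y u t xi s c : R) (z : int) :
  (k < N)%N -> 1 <= L -> 0 <= Th <= 1 -> m%:R <= L ^+ 2 ->
  0 <= y <= L * N%:R -> `|L * y - m%:R * Th - z%:~R| <= (64 * N%:R)^-1 ->
  t = m%:R / (2 * pi * L ^+ 2) -> xi = L * (k%:R + Th / 2) -> s = L * Th / 2 ->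
  c = 2 * pi * (y * s - m%:R / L ^+ 2 * s ^+ 2) ->
  85/100 - 2/100 * (1000 * (L * N%:R) * (u - xi)) ^+ 2 <=
  cos (2 * pi * (y * u) - 4 * pi ^+ 2 * t * (u * u) - c).
Proof.
move=> kN L1 /andP[Th0 Th1] mL /andP[y0 yLN] Hz tE xiE sE cE.
have p0 : pi != 0 :> R by rewrite gt_eqF ?pi_gt0.
have L0 : 0 < L by exact: lt_le_trans L1.
have Ln0 : L != 0 by rewrite gt_eqF.
have N1 : 1 <= N%:R :> R by rewrite ler1n (leq_ltn_trans _ kN).
have kN1 : k%:R + 1 <= N%:R :> R by rewrite natr1 ler_nat.
have k0 : 0 <= k%:R :> R by [].
set r := L * N%:R.
have r1 : 1 <= r by rewrite /r; nra.
have yr : y <= r by exact: yLN.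
pose eps := L * y - m%:R * Th - z%:~R.
pose eta := u - xi; pose nu : R := m%:R / L ^+ 2.
have nu0 : 0 <= nu by rewrite divr_ge0 ?sqr_ge0.
have nu1 : nu <= 1 by rewrite ler_pdivrMr ?exprn_gt0// mul1r.
have xi0 : 0 <= xi by rewrite xiE; nra.
have xir : xi <= r by rewrite xiE /r; nra.
(* In turns, [d] is what remains of the phase once [c] and the integer [k z - m k^2] are removed:
   the focusing error, the drift linear in the frequency offset [eta], and the dispersion. *)
pose d := k%:R * eps + eta * (y - 2 * nu * xi) - nu * eta ^+ 2.
have -> : 2 * pi * (y * u) - 4 * pi ^+ 2 * t * (u * u) - c =
    2 * pi * d + 2 * pi * (k%:Z * z - m%:Z * k%:Z ^+ 2)%:~R.
  rewrite intrB !intrM -!pmulrn.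
  rewrite /d /eps /eta cE sE tE /nu xiE; move: (pi : R) p0 (z%:~R : R) (m%:R : R) (k%:R : R).
  by move=> p p0 z' m' k'; field; rewrite p0 Ln0.
rewrite cosDint; apply: le_trans (cos_ge1B _).
rewrite normrM (ger0_norm (_ : 0 <= 2 * pi)) ?mulr_ge0 ?pi_ge0//.
have dle : `|d| <= 1/64 + 2 * r * `|eta| + eta ^+ 2.
  rewrite /d (le_trans (ler_normB _ _))// lerD//.
    rewrite (le_trans (ler_normD _ _))// lerD//.
      rewrite normrM ger0_norm//.
      have : N%:R * `|eps| <= 1/64.
        rewrite -ler_pdivlMl; last by rewrite (lt_le_trans _ N1).
        by rewrite (le_trans Hz)// invfM mulrC mul1r.
      by have := normr_ge0 eps; nra.
    rewrite normrM mulrC ler_wpM2r// ler_norml.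
    have nx0 : 0 <= nu * xi by rewrite mulr_ge0.
    have nx1 : nu * xi <= r by rewrite (le_trans _ xir)// ler_piMl.
    by rewrite -mulrA; move: (nu * xi) nx0 nx1 => w w0 w1; apply/andP; split; lra.
  rewrite normrM (ger0_norm nu0) normrX real_normK ?num_real//.
  by rewrite ler_piMl ?sqr_ge0.
have := @pi_le4 R; have := @pi_ge2 R; move: (pi : R) => p p2 p4.
rewrite -/eta exprMn.
have -> : 1000 * r = r * 1000 by ring.
set q := r * `|eta|.
have q0 : 0 <= q by rewrite mulr_ge0 ?(le_trans _ r1).
have etaq : (r * 1000) ^+ 2 * eta ^+ 2 = 1000 ^+ 2 * q ^+ 2.
  by rewrite /q exprMn [(_ * `|eta|) ^+ 2]exprMn real_normK ?num_real//; ring.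
have eq2 : eta ^+ 2 <= q ^+ 2.
  rewrite /q exprMn real_normK ?num_real// ler_peMl ?sqr_ge0//; nra.
rewrite etaq; move: dle; rewrite -mulrA -/q => dle.
have d0 : 0 <= `|d| by [].
(* As [pi <= 4], the focusing error costs [8 / 64], and [1 - 1/8] exceeds [85/100] by [1/40]. The
   factor 1000 in [W] makes the allowed loss [20000 q^2], and the square [(500 q - 1)^2] absorbs the
   linear term [16 q] into it and that slack. *)
have : 2 * p * `|d| <= 8 * (1/64 + 2 * q + q ^+ 2) by nra.
have := sqr_ge0 (500 * q - 1); nra.
Qed.

(** The phase [c] is common to all [k]: after rotation by [cis (- c)] every packet has real part at
    least [1 / 2], so the real parts add without cancellation. *)
Lemma evolution_lower_bound (N m : nat) (L Th y W : R) (z : int) :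
  (0 < N)%N -> 1 <= L -> 0 <= Th <= 1 -> m%:R <= L ^+ 2 ->
  0 <= y <= L * N%:R -> `|L * y - m%:R * Th - z%:~R| <= (64 * N%:R)^-1 ->
  W = 1000 * (L * N%:R) ->
  N%:R / 2 <= Normc.normc (\sum_(k < N) cint mu (fun u =>
    (packet_hat W (L * (k%:R + Th / 2)) u)%:C *
    cis (2 * pi * (y * u) - 4 * pi ^+ 2 * (m%:R / (2 * pi * L ^+ 2)) * (u * u)))).
Proof.
move=> N0 L1 hTh mL hy Hz WE.
have N1 : 1 <= N%:R :> R by rewrite ler1n.
have W0 : 0 < W by rewrite WE; nra.
set c := 2 * pi * (y * (L * Th / 2) - m%:R / L ^+ 2 * (L * Th / 2) ^+ 2).
set S := \sum_(k < N) _.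
have -> : Normc.normc S = Normc.normc (cis (- c) * S).
  by rewrite Normc.normcM normc_cis mul1r.
apply: le_trans (normc_ge_Re _); rewrite /S mulr_sumr.
have -> : N%:R / 2 = \sum_(k < N) (2^-1 : R) by rewrite sumr_const card_ord mulr_natl.
rewrite Re_sum; apply: ler_sum => k _; apply: (cos_phase_lower_bound W0).
  move=> u; apply: cvgB; (apply: cvgM; first exact: cvg_cst); apply: cvgM;
    by [exact: cvg_cst|exact: cvg_id].
by move=> u; rewrite WE; exact: (@phase_bound _ _ _ _ _ _ _ _ _ _ _ _ (ltn_ord k) L1 hTh mL hy Hz).
Qed.

End evolution_bound.

(** * Upper bound for the Sobolev norm *)

Section sobolev_bound.
Context {R : realType}.
Notation mu := (@lebesgue_measure R).
Local Notation "x %:C" := (Complex x 0).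

(** Comparison with the integral of [1 / (1 + x^2)] over unit intervals centred at the points
    [k - u], on which the central value is at most twice any other. The arctangents telescope to at
    most [pi], and [2 pi <= 8]. *)
Lemma sum_inv_sqr_le N (u : R) : \sum_(k < N) (1 + (k%:R - u) ^+ 2)^-1 <= 8.
Proof.
pose A k : R := atan (k%:R - u - 1/2).
have step k : (1 + (k%:R - u) ^+ 2)^-1 <= 2 * (A k.+1 - A k).
  set v := k%:R - u.
  have [c] : exists2 c, c \in `[v - 1/2, v + 1/2]%R &
      atan (v + 1/2) - atan (v - 1/2) = (1 + c ^+ 2)^-1 * (v + 1/2 - (v - 1/2)).
    apply: (@MVT_segment _ _ (fun z => (1 + z ^+ 2)^-1)); first lra.
    by apply: continuous_subspaceT => x; exact: continuous_atan.
  rewrite in_itv/= => /andP[c1 c2] E.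
  have -> : A k.+1 - A k = (1 + c ^+ 2)^-1.
    rewrite /A -natr1 (_ : k%:R + 1 - u - 1/2 = v + 1/2); last by rewrite /v; lra.
    by rewrite -/v E (_ : _ - _ = 1 :> R) ?mulr1//; lra.
  have cp : 0 < 1 + c ^+ 2 by rewrite ltr_pwDl ?sqr_ge0.
  have vp : 0 < 1 + v ^+ 2 by rewrite ltr_pwDl ?sqr_ge0.
  rewrite -[leLHS]mul1r ler_pdivrMr// mulrAC ler_pdivlMr// mul1r.
  have d1 : 0 <= (v + 1/2 - c) * (c - (v - 1/2)) by rewrite mulr_ge0// subr_ge0.
  by have := sqr_ge0 (c - 2 * v); nra.
have le_sum : \sum_(k < N) (1 + (k%:R - u) ^+ 2)^-1 <= \sum_(k < N) (2 * (A k.+1 - A k)).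
  by apply: ler_sum => k _; exact: step.
rewrite (le_trans le_sum)// -mulr_sumr -(big_mkord xpredT (fun k => A k.+1 - A k)).
rewrite telescope_sumr//.
have a1 := atan_ltpi2 (N%:R - u - 1/2); have a2 := atan_gtNpi2 (0%:R - u - 1/2).
have := @pi_le4 R; rewrite /A; lra.
Qed.

(** The spacing [L] is at least the frequency width [1 / W], so the packets hardly overlap:
    [exp (- x) <= 1 / (1 + x)] reduces to the preceding sum, with a bound independent of [N]. *)
Lemma packet_sum_hat_le (N : nat) (W L s z : R) : 0 < W -> 1 <= W * L ->
  \sum_(k < N) packet_hat W (L * (k%:R + s)) z <= 8 * W.
Proof.
move=> W0 WL; rewrite /packet_hat -mulr_sumr mulrC ler_pM2r//.
apply: le_trans (sum_inv_sqr_le N (z / L - s)); apply: ler_sum => k _.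
have L0 : L != 0 by apply: contraTneq WL => ->; rewrite mulr0 -ltNge.
set v := k%:R - (z / L - s).
have -> : pi * W ^+ 2 * (z - L * (k%:R + s)) ^+ 2 = pi * (W * L) ^+ 2 * v ^+ 2.
  by rewrite /v; move: (pi : R) => p; field.
have vp : 0 < 1 + v ^+ 2 by rewrite ltr_pwDl ?sqr_ge0.
rewrite expRN lef_pV2 ?posrE ?expR_gt0// (le_trans _ (expR_ge1Dx _))// lerD2l.
rewrite ler_peMl ?sqr_ge0//.
have := @pi_ge2 R; have : 1 <= (W * L) ^+ 2 by rewrite exprn_ege1.
move: ((W * L) ^+ 2) => w w1; nra.
Qed.

(** One factor of the square is bounded by [8 W], which leaves a sum linear in the packets. Each of
    the [N] packets has weighted mass at most [3 + 2 * 2 = 7], whence [56 = 8 * 7]. *)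
Lemma weighted_packet_sum (N : nat) (L s r W : R) :
  (0 < N)%N -> 1 <= L -> 0 <= s <= 1/2 ->
  r = L * N%:R -> W = 1000 * r ->
  let h z := (1 + z ^+ 2 / r ^+ 2) *
             (\sum_(k < N) packet_hat W (L * (k%:R + s)) z) ^+ 2 in
  mu.-integrable setT (EFin \o h) /\ \int[mu]_z h z <= 56 * N%:R * W.
Proof.
move=> N0 L1 /andP[s0 s1] rE WE h.
have L0 : 0 < L by exact: lt_le_trans L1.
have N1 : 1 <= N%:R :> R by rewrite ler1n.
have r1 : 1 <= r by rewrite rE; nra.
have r0 : 0 < r by exact: lt_le_trans r1.
have W0 : 0 < W by rewrite WE; lra.
pose xi (k : 'I_N) := L * (k%:R + s).
pose g (k : 'I_N) (z : R) := 3 * packet_hat W (xi k) z +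
  2 * (W * expR (- (pi * W ^+ 2 / 2 * (z - xi k) ^+ 2))).
have ig1 k := integrableZl measurableT 3 (integrable_packet_hat (xi k) W0).
have ig2 k := integrableZl measurableT 2 (integrable_gaussian_half (xi k) W0).
have ig k : mu.-integrable setT (EFin \o g k).
  by have := integrableD measurableT (ig1 k) (ig2 k); apply: eq_integrable.
have g7 k : \int[mu]_z g k z <= 7.
  rewrite /g (RintegralD measurableT (ig1 k) (ig2 k)).
  rewrite (RintegralZl _ measurableT (integrable_packet_hat (xi k) W0)).
  rewrite (RintegralZl _ measurableT (integrable_gaussian_half (xi k) W0)).
  rewrite Rintegral_packet_hat//.
  by have := integral_gaussian_half (xi k) W0; lra.
have [iS SE] := Rintegral_sum ig.
have iB := integrableZl measurableT (8 * W) iS.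
have ph0 k z := packet_hat_ge0 (xi k) z W0.
have w0 z : 0 <= 1 + z ^+ 2 / r ^+ 2 by rewrite addr_ge0// divr_ge0 ?sqr_ge0.
have h0 z : 0 <= h z by rewrite mulr_ge0 ?sqr_ge0.
have hB z : h z <= 8 * W * \sum_(k < N) g k z.
  rewrite /h expr2 mulrCA; set S := \sum_(k < N) packet_hat _ _ _.
  have S0 : 0 <= S by rewrite sumr_ge0// => k _; exact: ph0.
  have S8 : S <= 8 * W.
    by apply: packet_sum_hat_le => //; rewrite WE rE; nra.
  apply: ler_pM => //; first exact: mulr_ge0 (w0 z) S0.
  rewrite mulr_sumr; apply: ler_sum => k _; rewrite -/(xi k) /g.
  (* Since [xi k <= r], the inequality [z^2 <= 2 xi^2 + 2 eta^2] bounds the weight by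
     [3 + 2 eta^2 / r^2]; the offset is then measured in the unit [1 / W] to match
     [packet_hat_moment]. *)
  apply: (@le_trans _ _ ((3 + 2 * (W * (z - xi k)) ^+ 2) * packet_hat W (xi k) z)).
    rewrite ler_wpM2r// -lerBrDl ler_pdivrMr ?exprn_gt0//.
    have x0 : 0 <= xi k by rewrite /xi mulr_ge0 ?(ltW L0) ?addr_ge0.
    have xr : xi k <= r.
      rewrite /xi rE ler_pM2l//; have : k%:R + 1 <= N%:R :> R by rewrite natr1 ler_nat.
      by lra.
    rewrite exprMn WE; set eta := z - xi k.
    have zE : z ^+ 2 <= 2 * xi k ^+ 2 + 2 * eta ^+ 2.
      by rewrite /eta; have := sqr_ge0 (z - 2 * xi k); nra.
    have x2 : xi k ^+ 2 <= r ^+ 2 by rewrite ler_sqr ?nnegrE// ltW.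
    have e2 := sqr_ge0 eta.
    have r2 : 1 <= r ^+ 2 by rewrite exprn_ege1.
    have : eta ^+ 2 <= (1000 * r) ^+ 2 * eta ^+ 2 * r ^+ 2.
      rewrite mulrAC ler_peMl// exprMn; nra.
    by nra.
  rewrite mulrDl lerD2l -mulrA ler_pM2l//; exact: packet_hat_moment.
have mh : measurable_fun setT h.
  apply: measurable_funM.
    by apply: measurable_funD => //; apply: measurable_funM => //; exact: measurable_funX.
  apply: measurable_funX; apply/measurable_EFinP.
  exact: (measurable_int mu (proj1 (Rintegral_sum
    (fun k : 'I_N => integrable_packet_hat (xi k) W0)))).
have ih : mu.-integrable setT (EFin \o h).
  apply: (le_integrable measurableT _ _ iB) => /=; first exact/measurable_EFinP.
  move=> z _; rewrite lee_fin (ger0_norm (h0 z)) (le_trans (hB z))//.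
  exact: ler_norm.
split=> //; apply: (@le_trans _ _ (\int[mu]_z (8 * W * \sum_(k < N) g k z))).
  exact: le_Rintegral.
rewrite (RintegralZl _ measurableT iS) SE.
rewrite (_ : 56 * N%:R * W = 8 * W * (N%:R * 7)); last by ring.
have W8 : 0 < 8 * W by rewrite mulr_gt0.
have -> : N%:R * 7 = \sum_(k < N) (7 : R) by rewrite sumr_const card_ord mulr_natl.
rewrite ler_pM2l//; by apply: ler_sum => k _; exact: g7.
Qed.

End sobolev_bound.

(** * Norms on the whole space *)

Section norms.
Context {R : realType}.
Local Notation "x %:C" := (Complex x 0).

Lemma integral_tensor n (h : 'I_n -> R -> R) :
  (forall j, (@lebesgue_measure R).-integrable setT (EFin \o h j)) ->
  measurable_fun setT (fun x : 'rV[R]_n => \prod_(j < n) h j (x ord0 j)) /\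
  (\int[lebesgue_rV R n]_x (\prod_(j < n) h j (x ord0 j))%:E =
  (\prod_(j < n) \int[lebesgue_measure]_z h j z)%:E)%E.
Proof.
move=> ih.
have ic j : cintegrable lebesgue_measure (fun z => (h j z)%:C).
  by split; [exact: ih|exact: integrable0].
have [[i1 _] E] := cintegral_tensor ic.
have {}i1 : (lebesgue_rV R n).-integrable setT
    (EFin \o (fun x : 'rV[R]_n => \prod_(j < n) h j (x ord0 j))).
  by apply: (eq_integrable measurableT _ _ _ i1) => x _ /=; rewrite prod_real_complex.
split; first by apply/measurable_EFinP; exact: measurable_int i1.
rewrite -[LHS]fineK; last exact: integrable_fin_num i1.
congr EFin; have := congr1 (fun z : R[i] => complex.Re z) E; rewrite /cintegral /=.
under eq_Rintegral do rewrite prod_real_complex.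
move=> E2; apply: (etrans E2).
rewrite (eq_bigr (fun j => (\int[lebesgue_measure]_z h j z)%:C)).
  by rewrite prod_real_complex.
by move=> j _; rewrite /cint /Rintegral integral0.
Qed.

Lemma measurable_box n (A : 'I_n -> set (measurableTypeR R)) :
  (forall i, measurable (A i)) -> measurable [set x : 'rV[R]_n | forall i, A i (x ord0 i)].
Proof.
move=> mA; rewrite (_ : mkset _ = \big[setI/setT]_(i < n)
    ((fun x : 'rV[R]_n => x ord0 i) @^-1` A i)).
  apply: big_rec => // i B _ mB; apply: measurableI => //.
  by rewrite -[X in measurable X]setTI; exact: measurable_rV_coord.
rewrite -bigcap_seq; apply/seteqP; split=> x /= Ax i; first by move=> _; exact: Ax.
by apply: Ax => /=; rewrite mem_index_enum.
Qed.

Lemma Lnorm2_box_lower_bound n (f : 'rV[R]_n -> \bar R) (r c : R) :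
  0 <= r -> 0 <= c ->
  (forall x : 'rV[R]_n, (forall i, 0 <= x ord0 i <= r) -> (c%:E <= f x)%E) ->
  ((c ^+ 2 * r ^+ n)%:E <= 'N[lebesgue_rV R n]_2%:E[f] `^ 2)%E.
Proof.
move=> r0 c0 cf; rewrite poweR_Lnorm//.
pose B := [set x : 'rV[R]_n | forall i, `[0, r]%classic (x ord0 i)].
have mB : measurable B.
  by apply: (@measurable_box n (fun=> [set` `[0, r]])) => i; exact: measurable_itv.
have muB : lebesgue_rV R n B = (r ^+ n)%:E.
  rewrite /B (@lebesgue_rV_box R n (fun=> [set` `[0, r]])); last by move=> i; exact: measurable_itv.
  rewrite (eq_bigr (fun=> r%:E)); last first.
    move=> i _; rewrite lebesgue_measure_itv/= lte_fin oppr0 adde0.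
    by move: r0; rewrite le_eqVlt => /predU1P[<-|->]; rewrite ?ltxx.
  by rewrite prodEFin big_const_ord iter_mulr_1.
have -> : ((c ^+ 2 * r ^+ n)%:E = \int[lebesgue_rV R n]_(x in B) (c ^+ 2)%:E)%E.
  by rewrite integral_cst// EFinM; congr (_ * _)%E; exact: esym muB.
apply: le_integral_nonmeasurable => [x _|x|x Bx].
- by rewrite lee_fin sqr_ge0.
- exact: poweR_ge0.
have fx : (c%:E <= f x)%E by apply: cf => i; have := Bx i; rewrite /= in_itv.
have f0 : (0 <= f x)%E by apply: le_trans fx; rewrite lee_fin.
rewrite gee0_abs//.
have := @gt0_ler_poweR R 2 (ler0n _ _).
rewrite -powR_mulrn// -poweR_EFin; apply => //.
- by rewrite in_itv/= lee_fin c0 leey.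
- by rewrite in_itv/= f0 leey.
Qed.

(** The Sobolev weight is not a product over the coordinates; this majorant is, which lets the
    integral factor. With [u = (1 + |x|^2) / r^2], it rests on [u^s' <= 1 + u] for [0 <= s' <= 1]
    and on [1 + sum a_j <= prod (1 + a_j)] for nonnegative [a_j]. *)
Lemma sobolev_weight_le (n : nat) (r s s' : R) (x : 'rV[R]_n) :
  1 <= r -> 0 <= s' <= 1 -> s <= s' ->
  (1 + dot x x) `^ s <= 2 * (r ^+ 2) `^ s' * \prod_(j < n) (1 + x ord0 j ^+ 2 / r ^+ 2).
Proof.
move=> r1 /andP[s0 s1] ss.
have r0 : 0 < r by exact: lt_le_trans r1.
have r2 : 1 <= r ^+ 2 by rewrite exprn_ege1.
have dE : dot x x = \sum_(j < n) x ord0 j ^+ 2 by apply: eq_bigr => j _; rewrite expr2.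
have d0 : 0 <= dot x x by rewrite dE sumr_ge0// => j _; exact: sqr_ge0.
apply: (@le_trans _ _ ((1 + dot x x) `^ s')); first by rewrite ler_powR// lerDl.
set u := (1 + dot x x) / r ^+ 2.
have u0 : 0 <= u by rewrite divr_ge0 ?sqr_ge0// addr_ge0.
have -> : 1 + dot x x = r ^+ 2 * u by rewrite /u mulrC divfK// gt_eqF// exprn_gt0.
rewrite powRM ?sqr_ge0// mulrAC mulrC ler_wpM2r ?powR_ge0//.
have uu : u `^ s' <= 1 + u.
  have [u1|/ltW u1] := leP 1 u.
    by rewrite (le_trans (ler1_powR u1 s1))// lerDr.
  have := ge0_ler_powR s0 (_ : u \in Num.nneg) (_ : 1 \in Num.nneg) u1.
  rewrite !nnegrE powR1 => /(_ u0 ler01) H.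
  by rewrite (le_trans H)// lerDl.
apply: le_trans uu _.
have P : 1 + \sum_(j < n) x ord0 j ^+ 2 / r ^+ 2 <= \prod_(j < n) (1 + x ord0 j ^+ 2 / r ^+ 2).
  elim: (index_enum _) => [|i l IH]; first by rewrite !big_nil addr0.
  rewrite !big_cons; set a := x ord0 i ^+ 2 / r ^+ 2.
  have a0 : 0 <= a by rewrite divr_ge0 ?sqr_ge0.
  have S0 : 0 <= \sum_(j <- l) x ord0 j ^+ 2 / r ^+ 2.
    by rewrite sumr_ge0// => j _; rewrite divr_ge0 ?sqr_ge0.
  by move: IH S0; nra.
have {}dE : dot x x / r ^+ 2 = \sum_(j < n) x ord0 j ^+ 2 / r ^+ 2 by rewrite dE mulr_suml.
have v1 : 1 / r ^+ 2 <= 1 by rewrite ler_pdivrMr ?exprn_gt0// mul1r.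
have v2 : 0 <= dot x x / r ^+ 2 by rewrite divr_ge0 ?sqr_ge0.
by move: P; rewrite /u mulrDl -dE; lra.
Qed.

Lemma sobolev_packet_sum (n N : nat) (L s s' r W : R) (sh : 'I_n -> R) :
  (0 < N)%N -> 1 <= L -> (forall j, 0 <= sh j <= 1/2) ->
  0 <= s' <= 1 -> s <= s' ->
  r = L * N%:R -> W = 1000 * r ->
  (sobolev_norm s (packet_sum W (fun j (k : 'I_N) => L * (k%:R + sh j))%R) `^ 2 <=
    (2 * (r ^+ 2) `^ s' * (56 * N%:R * W) ^+ n)%:E)%E.
Proof.
move=> N0 L1 hsh hs' ss rE WE.
have L0 : 0 < L by exact: lt_le_trans L1.
have N1 : 1 <= N%:R :> R by rewrite ler1n.
have r1 : 1 <= r by rewrite rE; nra.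
have r0 : 0 < r by exact: lt_le_trans r1.
have W0 : 0 < W by rewrite WE; lra.
pose xi j (k : 'I_N) := L * (k%:R + sh j).
pose h j z := (1 + z ^+ 2 / r ^+ 2) * (\sum_(k < N) packet_hat W (xi j k) z) ^+ 2.
have ih j : (@lebesgue_measure R).-integrable setT (EFin \o h j) /\
    \int[lebesgue_measure]_z h j z <= 56 * N%:R * W.
  exact: weighted_packet_sum N0 L1 (hsh j) rE WE.
have [mP EP] := integral_tensor (h := h) (fun j => proj1 (ih j)).
rewrite /sobolev_norm poweR_Lnorm//.
set K := 2 * (r ^+ 2) `^ s'.
have K0 : 0 <= K by rewrite mulr_ge0 ?powR_ge0.
have h0 j z : 0 <= h j z.
  by rewrite mulr_ge0 ?sqr_ge0// addr_ge0// divr_ge0 ?sqr_ge0.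
have Ph0 (x : 'rV[R]_n) : 0 <= \prod_(j < n) h j (x ord0 j).
  by rewrite prodr_ge0.
apply: (@le_trans _ _ (\int[lebesgue_rV R n]_x (K * \prod_(j < n) h j (x ord0 j))%:E)%E).
  apply: le_integral_nonmeasurable => [x _|x|x _].
  - exact: poweR_ge0.
  - by rewrite lee_fin mulr_ge0.
  rewrite /comp gee0_abs; last by rewrite lee_fin mulr_ge0 ?powR_ge0// normc_ge0.
  rewrite poweR_EFin lee_fin powR_mulrn; last by rewrite mulr_ge0 ?powR_ge0// normc_ge0.
  rewrite exprMn -powR_mulrn ?powR_ge0// -powRrM divfK//.
  rewrite fourier_packet_sum// normc_prod -prodrXl.
  rewrite (eq_bigr (fun j => (packet_sum_hat W xi j (x ord0 j)) ^+ 2)); last first.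
    by move=> j _; rewrite normc_real real_normK ?num_real.
  apply: (le_trans (ler_wpM2r _ (sobolev_weight_le x r1 hs' ss))).
    by rewrite prodr_ge0// => j _; exact: sqr_ge0.
  by rewrite -[leLHS]mulrA -big_split.
under eq_integral do rewrite EFinM.
rewrite ge0_integralZl//=; last 2 first.
- exact/measurable_EFinP.
- by move=> x _; rewrite lee_fin.
rewrite EP -EFinM lee_fin ler_wpM2l//.
rewrite -[n in _ ^+ n]card_ord -prodr_const; apply: ler_prod => j _.
rewrite (ih j).2 andbT; apply: Rintegral_ge0 => z _; exact: h0.
Qed.

End norms.

(** * The two bounds confronted *)

Section maximal.
Context {R : realType}.

Lemma schroedinger_max_packet_sum (n N : nat) (L r W : R) (x : 'rV[R]_n) :
  (0 < N)%N -> L = Num.sqrt ((64 * N%:R) ^+ n) -> r = L * N%:R -> W = 1000 * r ->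
  (forall i, 0 <= x ord0 i <= r) ->
  (((N%:R / 2) ^+ n)%:E <= schroedinger_max (packet_sum W
     (fun (j : 'I_n) (k : 'I_N) => L * (k%:R + (64 * N%:R) ^- j.+1 / 2))%R) x)%E.
Proof.
move=> N0 LE rE WE xr.
have N1 : 1 <= N%:R :> R by rewrite ler1n.
have q1 : 1 <= 64 * N%:R :> R by lra.
have Q0 : (0 < 64 * N)%N by rewrite muln_gt0.
have QE : (64 * N)%:R = 64 * N%:R :> R by rewrite natrM.
have L2 : L ^+ 2 = (64 * N%:R) ^+ n by rewrite LE sqr_sqrtr// exprn_ge0// (le_trans ler01).
have L1 : 1 <= L by rewrite LE -[leLHS]sqrtr1 ler_sqrt ?exprn_ege1// exprn_ge0// (le_trans ler01).
have r1 : 1 <= r by rewrite rE; nra.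
have W0 : 0 < W by rewrite WE; lra.
(* The digits are indexed by naturals, so the targets [L x_j] are extended by 0 beyond the [n]
   coordinates. *)
pose y j : R := if insub j is Some i then L * x ord0 i else 0.
have [m /andP[m0 mQ] Hm] := simultaneous_positive_digits n y Q0.
have mL : m%:R <= L ^+ 2 by rewrite L2 -QE -natrX ler_nat.
pose t : R := m%:R / (2 * pi * L ^+ 2).
have L20 : 0 < L ^+ 2 by rewrite exprn_gt0// (lt_le_trans ltr01).
(* From [m <= L^2] comes [t <= 1 / (2 pi)], while [0 < m] excludes the initial time. *)
have t01 : 0 < t < 1.
  have D0 : 0 < 2 * pi * L ^+ 2 by rewrite mulr_gt0// mulr_gt0// pi_gt0.
  apply/andP; split; first by rewrite divr_gt0// ltr0n.
  rewrite ltr_pdivrMr// mul1r (le_lt_trans mL)// ltr_pMl//.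
  by have := @pi_ge2 R; lra.
apply: (@le_trans _ _ (Normc.normc (schroedinger t (packet_sum W
     (fun (j : 'I_n) (k : 'I_N) => L * (k%:R + (64 * N%:R) ^- j.+1 / 2))) x))%:E); last first.
  by apply: ereal_sup_ubound; exists t => //; rewrite /= in_itv.
rewrite lee_fin schroedinger_packet_sum// normc_prod.
rewrite -[n in _ ^+ n]card_ord -prodr_const; apply: ler_prod => j _.
rewrite divr_ge0//=.
have [z] := Hm j (ltn_ord j); rewrite /y valK QE => Hz.
apply: evolution_lower_bound => //; last by rewrite WE rE.
- rewrite invr_ge0 exprn_ge0 ?(le_trans ler01)//= invf_le1 ?exprn_ege1//.
  by rewrite exprn_gt0// (lt_le_trans ltr01).
- by rewrite -rE.
- exact: Hz.
Qed.

Lemma powR_unbounded (e D : R) : 0 < e -> exists2 N : nat, (0 < N)%N & D < N%:R `^ e.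
Proof.
move=> e0; pose X := (`|D| + 1) `^ e^-1.
exists (Num.truncn X).+1 => //.
have XN : X < (Num.truncn X).+1%:R by exact: truncnS_gt.
have D1 : 0 <= `|D| + 1 by rewrite addr_ge0.
have := gt0_ltr_powR e0 (_ : X \in Num.nneg) (_ : _ \in Num.nneg) XN.
rewrite !nnegrE powR_ge0 ler0n => /(_ isT isT).
rewrite /X -powRrM mulVf ?gt_eqF// powRr1//; apply: le_lt_trans.
by rewrite (le_trans (ler_norm D))// lerDl.
Qed.

(** After squaring, the two bounds combine to [(N/2)^(2 n) r^n <= C^2 * 2 r^(2 s') (56000 N r)^n].
    Division by [(N r / 4)^n] gives the claim, with [r^2 = (64 N)^n N^2]. *)
Lemma maximal_estimate_growth (n N : nat) (s s' C : R) :
  0 <= s' <= 1 -> s <= s' -> (0 < N)%N ->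
  (forall f : 'rV[R]_n -> R[i], schwartz f ->
    ('N[lebesgue_rV R n]_2%:E[schroedinger_max f] <= C%:E * sobolev_norm s f)%E) ->
  N%:R ^+ n <= `|C| ^+ 2 * 2 * (4 * 56 * 1000) ^+ n *
    ((64 * N%:R) ^+ n * N%:R ^+ 2) `^ s'.
Proof.
move=> hs' ss N0 HC.
pose L : R := Num.sqrt ((64 * N%:R) ^+ n).
(* [W] is kept abstract: side conditions are very slow on the unary numeral 1000. *)
have [r rE] : exists r, r = L * N%:R by eexists.
have [W WE] : exists W, W = 1000 * r by eexists.
have N1 : 1 <= N%:R :> R by rewrite ler1n.
have q1 : 1 <= 64 * N%:R :> R by lra.
have L2 : L ^+ 2 = (64 * N%:R) ^+ n by rewrite /L sqr_sqrtr// exprn_ge0// (le_trans ler01).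
have L1 : 1 <= L by rewrite /L -[leLHS]sqrtr1 ler_sqrt ?exprn_ege1// exprn_ge0// (le_trans ler01).
have r1 : 1 <= r by rewrite rE; nra.
have W0 : 0 < W by rewrite WE; lra.
set f := packet_sum W (fun (j : 'I_n) (k : 'I_N) => L * (k%:R + (64 * N%:R) ^- j.+1 / 2)).
have sf : schwartz f by exact: schwartz_packet_sum.
have lower := Lnorm2_box_lower_bound (le_trans ler01 r1) (_ : 0 <= (N%:R / 2) ^+ n)
  (fun x => schroedinger_max_packet_sum N0 (erefl L) rE WE).
have {}lower := lower (exprn_ge0 _ (divr_ge0 (ler0n _ _) (ler0n _ _))).
have upper : (sobolev_norm s f `^ 2 <=
    (2 * (r ^+ 2) `^ s' * (56 * N%:R * W) ^+ n)%:E)%E.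
  apply: sobolev_packet_sum => // j.
  have h0 : 0 < (64 * N%:R) ^+ j.+1 :> R by rewrite exprn_gt0// (lt_le_trans ltr01).
  have h1 : (64 * N%:R) ^- j.+1 <= 1 :> R by rewrite invf_le1// exprn_ege1.
  have h2 : 0 <= (64 * N%:R) ^- j.+1 :> R by rewrite invr_ge0 ltW.
  by apply/andP; split; lra.
have sob0 : (0 <= sobolev_norm s f)%E by exact: Lnorm_ge0.
(* With [|C|] in place of [C] both sides are nonnegative, so that squaring preserves the order. *)
have H : ('N[lebesgue_rV R n]_2%:E[schroedinger_max f] <= `|C|%:E * sobolev_norm s f)%E.
  by rewrite (le_trans (HC f sf))// lee_wpmul2r// lee_fin ler_norm.
have {}H : ('N[lebesgue_rV R n]_2%:E[schroedinger_max f] `^ 2 <=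
            (`|C|%:E * sobolev_norm s f) `^ 2)%E.
  apply: gt0_ler_poweR H => //; rewrite in_itv/= leey andbT; first exact: Lnorm_ge0.
  by rewrite mule_ge0// lee_fin.
rewrite poweRM ?lee_fin// poweR_EFin powR_mulrn// in H.
have {lower}H := le_trans lower H.
have {upper}H := le_trans H (lee_wpmul2l (_ : 0 <= (`|C| ^+ 2)%:E)%E upper).
have {H} := H (_ : (0 <= (`|C| ^+ 2)%:E)%E); rewrite -EFinM !lee_fin => /(_ (sqr_ge0 _)).
rewrite -L2 -exprMn -rE -/(GRing.exp r 2) WE.
set P := (r ^+ 2) `^ s'.
have P0 : 0 <= P by exact: powR_ge0.
have a0 : 0 < (N%:R * r / 4) ^+ n by rewrite exprn_gt0// divr_gt0// mulr_gt0; lra.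
rewrite -exprM mulnC exprM -exprMn.
have -> : (N%:R / 2) ^+ 2 * r = N%:R * (N%:R * r / 4) by field.
have -> : 56 * N%:R * (1000 * r) = 4 * 56 * 1000 * (N%:R * r / 4) by field.
rewrite (exprMn n N%:R) (exprMn n (4 * 56 * 1000)) => H.
rewrite -(ler_pM2r a0); apply: le_trans H _.
by rewrite le_eqVlt; apply/orP; left; apply/eqP; ring.
Qed.

End maximal.

(** The growth inequality has the form [N^n <= K N^((n+2) s')] with [K] independent of [N]. Below
    the threshold the exponent [n - (n+2) s'] is positive, and a large [N] contradicts it. *)
Theorem corollary1p3 (R : realType) (n : nat) (s : R) :
  (3 <= n)%N ->
  (exists C : R, forall f : 'rV[R]_n -> R[i], schwartz f ->
    ('N[lebesgue_rV R n]_2%:E[schroedinger_max f] <= C%:E * sobolev_norm s f)%E) ->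
  n%:R / (n%:R + 2) <= s.
Proof.
move=> n3 [C HC]; rewrite leNgt; apply/negP => sn.
have n0 : 0 < n%:R :> R by rewrite ltr0n (leq_trans _ n3).
have n2 : 0 < n%:R + 2 :> R by lra.
(* The weight estimate takes an exponent in [[0, 1]], while [s] may be negative. Raising [s] to 0
   stays below the threshold, which is positive. *)
pose s' := Num.max s 0.
have ss : s <= s' by rewrite le_max lexx.
have s0 : 0 <= s' by rewrite le_max lexx orbT.
have s'n : s' < n%:R / (n%:R + 2) by rewrite gt_max sn divr_gt0.
have s1 : s' <= 1.
  by rewrite (le_trans (ltW s'n))// ler_pdivrMr// mul1r; lra.
have e0 : 0 < n%:R - (n%:R + 2) * s'.
  by rewrite subr_gt0 mulrC -ltr_pdivlMr.
pose K : R := `|C| ^+ 2 * 2 * (4 * 56 * 1000) ^+ n * (64 ^+ n) `^ s'.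
have [N N0] := powR_unbounded K e0.
rewrite ltNge => /negP; apply.
have := maximal_estimate_growth (introT andP (conj s0 s1)) ss N0 HC.
have Nr : 0 < N%:R :> R by rewrite ltr0n.
have -> : (64 * N%:R) ^+ n * N%:R ^+ 2 = 64 ^+ n * N%:R ^+ (n + 2) :> R.
  by rewrite exprMn exprD mulrA.
rewrite powRM ?exprn_ge0// -[N%:R ^+ (n + 2)]powR_mulrn//.
rewrite -powRrM natrD -[N%:R ^+ n]powR_mulrn// mulrA -/K.
have {1}-> : n%:R = (n%:R - (n%:R + 2) * s') + (n%:R + 2) * s' :> R by rewrite subrK.
rewrite powRD; last by rewrite (gt_eqF Nr) implybT.
by rewrite ler_pM2r// powR_gt0.
Qed.
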